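(* Assume: (H1) $R\in\mathbb S^m_{++}$, $Q-S^\top R^{-1}S\in\mathbb S^n_{++}$, $Q+\bar Q-S^\top R^{-1}S\in\mathbb S^n_{++}$; (H2) the controlled ODE $\dot X(t)=(A+\bar A)X(t)+Bu(t)$ is stabilizable and the controlled SDE $dX(t)=(AX(t)+Bu(t))dt+(CX(t)+Du(t))dW(t)$ is $L^2$-stabilizable. For $T>0$ let $p(\cdot)$, $\Theta_T^*(\cdot)$, $\bar\Theta_T^*(\cdot)$, $\theta_T^*(\cdot)$ be the finite-horizon coefficient functions on $[0,T]$, and let $p$, $\Theta^*$, $\bar\Theta^*$, $\theta^*$ be the corresponding constants from the algebraic equations, all as defined in the context. Then there exist constants $K,\lambda>0$, independent of $T$, such that for all $t\in[0,T]$: $$\|\Theta_T^*(t)-\Theta^*\|\le Ke^{-\lambda(T-t)},\qquad \|\bar\Theta_T^*(t)-\bar\Theta^*\|\le Ke^{-\lambda(T-t)},$$ $$|p(t)-p|\le Ke^{-\lambda(T-t)},\qquad |\theta_T^*(t)-\theta^*|\le Ke^{-\lambda(T-t)}.$$ Consequently, $\Theta_T^*(\cdot)$, $\bar\Theta_T^*(\cdot)$, $\theta_T^*(\cdot)$ and $p(\cdot)$ are uniformly bounded on $[0,T]$.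
   Context: Notation: $\mathbb S^n$ (resp. $\mathbb S^n_{++}$) is the set of real symmetric (resp. positive definite) $n\times n$ matrices; $|\cdot|$ is the Euclidean norm and $\|\cdot\|$ the Frobenius norm. $W$ is a one-dimensional standard Brownian motion on a complete filtered probability space. Given are constant $A,\bar A,C,\bar C\in\mathbb R^{n\times n}$, $B,D\in\mathbb R^{n\times m}$, $b,\sigma,q\in\mathbb R^n$, $r\in\mathbb R^m$, $Q,\bar Q\in\mathbb S^n$, $S\in\mathbb R^{m\times n}$, $R\in\mathbb S^m$. Stabilizability: the ODE $\dot X=(A+\bar A)X+Bu$ is stabilizable if there is $\bar\Theta\in\mathbb R^{m\times n}$ such that all eigenvalues of $A+\bar A+B\bar\Theta$ have negative real parts. The SDE $dX=(AX+Bu)dt+(CX+Du)dW$ is $L^2$-stabilizable if there is $\Theta\in\mathbb R^{m\times n}$ such that for every $x\in\mathbb R^n$ the solution of $dX=(A+B\Theta)X\,dt+(C+D\Theta)X\,dW$, $X(0)=x$, satisfies $\mathbb E\int_0^\infty|X(t)|^2dt<\infty$. Write $\widehat A=A+\bar A$, $\widehat C=C+\bar C$, $\widehat Q=Q+\bar Q$, and for $P,\Pi\in\mathbb S^n$: $\mathcal Q(P)=PA+A^\top P+C^\top PC+Q$, $\widehat{\mathcal Q}(P,\Pi)=\Pi\widehat A+\widehat A^\top\Pi+\widehat C^\top P\widehat C+\widehat Q$, $\mathcal S(P)=B^\top P+D^\top PC+S$, $\widehat{\mathcal S}(P,\Pi)=B^\top\Pi+D^\top P\widehat C+S$, $\mathcal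 R(P)=R+D^\top PD$. Finite horizon: $P(\cdot),\Pi(\cdot)\in C^1([0,T];\mathbb S^n)$, $p(\cdot)\in C^1([0,T];\mathbb R^n)$ are the unique solution, with $P(t)\ge0$, $\Pi(t)\ge0$, of $$\dot P+\mathcal Q(P)-\mathcal S(P)^\top\mathcal R(P)^{-1}\mathcal S(P)=0,\quad \dot\Pi+\widehat{\mathcal Q}(P,\Pi)-\widehat{\mathcal S}(P,\Pi)^\top\mathcal R(P)^{-1}\widehat{\mathcal S}(P,\Pi)=0,$$ $$\dot p+[A+\bar A+B\bar\Theta_T^*]^\top p+[C+\bar C+D\bar\Theta_T^*]^\top P\sigma+(\bar\Theta_T^* )^\top r+\Pi b+q=0,$$ $P(T)=\Pi(T)=0$, $p(T)=0$, where $\Theta_T^*(t)=-\mathcal R(P(t))^{-1}\mathcal S(P(t))$, $\bar\Theta_T^*(t)=-\mathcal R(P(t))^{-1}\widehat{\mathcal S}(P(t),\Pi(t))$, $\theta_T^*(t)=-\mathcal R(P(t))^{-1}(B^\top p(t)+D^\top P(t)\sigma+r)$. Algebraic counterpart: $P,\Pi\in\mathbb S^n_{++}$, $p\in\mathbb R^n$ (constants, denoted by the same letters without time argument) are the unique solution with $P>0,\Pi>0$ of $$\mathcal Q(P)-\mathcal S(P)^\top\mathcal R(P)^{-1}\mathcal S(P)=0,\quad \widehat{\mathcal Q}(P,\Pi)-\widehat{\mathcal S}(P,\Pi)^\top\mathcal R(P)^{-1}\widehat{\mathcal S}(P,\Pi)=0,$$ $$(A+\bar A+B\bar\Theta^*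 )^\top p+(C+\bar C+D\bar\Theta^* )^\top P\sigma+(\bar\Theta^* )^\top r+\Pi b+q=0,$$ where $\Theta^*=-\mathcal R(P)^{-1}\mathcal S(P)$, $\bar\Theta^*=-\mathcal R(P)^{-1}\widehat{\mathcal S}(P,\Pi)$, $\theta^*=-\mathcal R(P)^{-1}(B^\top p+D^\top P\sigma+r)$. *)

(* Defs.v *)
From HB Require Import structures.
From mathcomp Require Import all_boot all_order all_algebra complex.
From mathcomp Require Import all_classical all_reals all_analysis.

Set Implicit Arguments.
Unset Strict Implicit.
Unset Printing Implicit Defensive.

Import Order.TTheory GRing.Theory Num.Theory.
Import numFieldNormedType.Exports.
Local Open Scope classical_set_scope.
Local Open Scope ring_scope.

(* The norm that MathComp-Analysis puts on matrices is the max norm, hence the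
   explicit Frobenius and Euclidean norms. *)
Definition frobenius (R : realType) (k l : nat) (M : 'M[R]_(k, l)) : R :=
  Num.sqrt (\sum_(i < k) \sum_(j < l) M i j ^+ 2).

Definition enorm (R : realType) (k : nat) (x : 'cV[R]_k) : R :=
  Num.sqrt (\sum_(i < k) x i 0 ^+ 2).

Definition symmetric_mx (R : realType) (k : nat) (M : 'M[R]_k) : Prop :=
  M^T = M.

Definition posdef_mx (R : realType) (k : nat) (M : 'M[R]_k) : Prop :=
  symmetric_mx M /\
  forall x : 'cV[R]_k, x != 0 -> 0 < (x^T *m M *m x) 0 0.

Definition possemidef_mx (R : realType) (k : nat) (M : 'M[R]_k) : Prop :=
  symmetric_mx M /\
  forall x : 'cV[R]_k, 0 <= (x^T *m M *m x) 0 0.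

(* F is C^1 on the closed interval [0, T] with derivative dF; at the endpoints
   the derivative is one-sided. *)
Definition C1_on (R : realType) (k l : nat) (T : R)
    (F dF : R -> 'M[R]_(k, l)) : Prop :=
  (forall t, t \in `[0, T] ->
     (s - t)^-1 *: (F s - F t) @[s --> within [set` `[0, T]] t^'] --> dF t) /\
  {within `[0, T], continuous dF}.

Definition ode_stabilizable (R : realType) (n m : nat)
    (A : 'M[R]_n) (B : 'M[R]_(n, m)) : Prop :=
  exists Theta : 'M[R]_(m, n), forall z : R[i],
    eigenvalue (map_mx (real_complex R) (A + B *m Theta)) z ->
    complex.Re z < 0.

Section StochasticCalculus.
Context (R : realType) (d : measure_display) (Omega : measurableType d).
Variable Pr : probability Omega R.
(* Time is indexed by R; only the times t >= 0 matter. *)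
Variables (F : R -> set (set Omega)) (W : R -> Omega -> R).

Notation mu := (@lebesgue_measure R).

Definition complete_filtration : Prop :=
  [/\ forall t, 0 <= t -> sigma_algebra setT (F t),
      forall t, 0 <= t -> F t `<=` measurable,
      forall s t, 0 <= s -> s <= t -> F s `<=` F t
    & Pr.-negligible `<=` F 0].

Definition measurable_at (t : R) (X : Omega -> R) : Prop :=
  forall E : set R, measurable E -> F t (X @^-1` E).

Definition increment (s t : R) (w : Omega) : R := W t w - W s w.

Definition brownian_motion : Prop :=
  [/\ forall t, 0 <= t -> measurable_at t (W t),
      {ae Pr, forall w, W 0 w = 0},
      {ae Pr, forall w, {within `[0, +oo[, continuous (W ^~ w)}},
      forall (s t : R) (E : set R), 0 <= s -> s < t -> measurable E ->
        Pr (increment s t @^-1` E)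
        = normal_prob 0 (Num.sqrt (t - s)) E
    & forall (s t : R) (G : set Omega) (E : set R),
        0 <= s -> s < t -> F s G -> measurable E ->
        Pr (G `&` increment s t @^-1` E)
        = (Pr G * Pr (increment s t @^-1` E))%E].

(* A simple process is a finite sum of xi(w) * 1_{]a, b]}(s) with xi bounded
   and F_a-measurable, encoded as the list of its summands ((a, b), xi); the
   intervals may overlap. *)
Definition simple_on (t : R) (h : seq (R * R * (Omega -> R))) : Prop :=
  forall k, (k < size h)%N ->
    let: (a, b, xi) := nth (0, 0, cst 0) h k in
    [/\ 0 <= a, a <= b, b <= t, measurable_at a xi
      & exists M : R, forall w, `|xi w| <= M].

Definition simple_val (h : seq (R * R * (Omega -> R))) (s : R) (w : Omega) : R :=
  \sum_(j <- h) j.2 w * (s \in `]j.1.1, j.1.2])%:R.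

Definition simple_integral (h : seq (R * R * (Omega -> R))) (w : Omega) : R :=
  \sum_(j <- h) j.2 w * (W j.1.2 w - W j.1.1 w).

(* I is (a version of) the Ito integral of H over [0, t] with respect to W: the
   mean-square limit of the integrals of simple processes converging to H in
   L^2([0, t] x Omega). *)
Definition is_ito_integral (t : R) (H : R -> Omega -> R) (I : Omega -> R) :
    Prop :=
  [/\ measurable_fun (`[0, t] `*` setT) (fun z : R * Omega => H z.1 z.2),
      measurable_at t I
    & exists h : nat -> seq (R * R * (Omega -> R)),
      [/\ forall k, simple_on t (h k),
          (\int[Pr]_w \int[mu]_(s in `[0%R, t])
             ((simple_val (h k) s w - H s w) ^+ 2)%:E)%E
             @[k --> \oo] --> 0%E
        & (\int[Pr]_w ((simple_integral (h k) w - I w) ^+ 2)%:E)%E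
             @[k --> \oo] --> 0%E]].

(* X is a (strong) solution of dX = A X dt + C X dW, X(0) = x. *)
Definition sde_solution (n : nat) (A C : 'M[R]_n) (x : 'cV[R]_n)
    (X : R -> Omega -> 'cV[R]_n) : Prop :=
  [/\ forall t i, 0 <= t -> measurable_at t (fun w => X t w i 0),
      forall w, {within `[0, +oo[, continuous (X ^~ w)},
      {ae Pr, forall w, X 0 w = x}
    & forall t (i : 'I_n), 0 <= t ->
        exists2 I : Omega -> R,
          is_ito_integral t (fun s w => (C *m X s w) i 0) I
        & {ae Pr, forall w, X t w i 0
             = x i 0 + \int[mu]_(s in `[0, t]) (A *m X s w) i 0 + I w}].

(* The solution of the linear closed-loop SDE exists and is unique up to
   indistinguishability, so "the solution satisfies" is "some solution
   satisfies". *)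
Definition L2_stabilizable (n m : nat) (A : 'M[R]_n) (B : 'M[R]_(n, m))
    (C : 'M[R]_n) (D : 'M[R]_(n, m)) : Prop :=
  exists Theta : 'M[R]_(m, n), forall x : 'cV[R]_n,
    exists2 X : R -> Omega -> 'cV[R]_n,
      sde_solution (A + B *m Theta) (C + D *m Theta) x X
    & (\int[Pr]_w \int[mu]_(t in `[0%R, +oo[) (enorm (X t w) ^+ 2)%:E
       < +oo)%E.

End StochasticCalculus.

Record lq_data (R : realType) (n m : nat) := LqData {
  cA : 'M[R]_n; cAbar : 'M[R]_n; cB : 'M[R]_(n, m);
  cC : 'M[R]_n; cCbar : 'M[R]_n; cD : 'M[R]_(n, m);
  cb : 'cV[R]_n; csigma : 'cV[R]_n;
  cQ : 'M[R]_n; cQbar : 'M[R]_n; cS : 'M[R]_(m, n); cR : 'M[R]_m;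
  cq : 'cV[R]_n; cr : 'cV[R]_m }.

Section Riccati.
Context (R : realType) (n m : nat).
Variable L : lq_data R n m.

Definition hatA := cA L + cAbar L.
Definition hatC := cC L + cCbar L.
Definition hatQ := cQ L + cQbar L.

Definition opQ (P : 'M[R]_n) : 'M[R]_n :=
  P *m cA L + (cA L)^T *m P + (cC L)^T *m P *m cC L + cQ L.
Definition opQhat (P Pi : 'M[R]_n) : 'M[R]_n :=
  Pi *m hatA + hatA^T *m Pi + hatC^T *m P *m hatC + hatQ.
Definition opS (P : 'M[R]_n) : 'M[R]_(m, n) :=
  (cB L)^T *m P + (cD L)^T *m P *m cC L + cS L.
Definition opShat (P Pi : 'M[R]_n) : 'M[R]_(m, n) :=
  (cB L)^T *m Pi + (cD L)^T *m P *m hatC + cS L.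
Definition opR (P : 'M[R]_n) : 'M[R]_m :=
  cR L + (cD L)^T *m P *m cD L.

Definition Theta_of (P : 'M[R]_n) : 'M[R]_(m, n) :=
  - (invmx (opR P) *m opS P).
Definition Thetabar_of (P Pi : 'M[R]_n) : 'M[R]_(m, n) :=
  - (invmx (opR P) *m opShat P Pi).
Definition theta_of (P : 'M[R]_n) (p : 'cV[R]_n) : 'cV[R]_m :=
  - (invmx (opR P) *m
     ((cB L)^T *m p + (cD L)^T *m P *m csigma L + cr L)).

Definition riccatiP (P : 'M[R]_n) : 'M[R]_n :=
  opQ P - (opS P)^T *m invmx (opR P) *m opS P.
Definition riccatiPi (P Pi : 'M[R]_n) : 'M[R]_n :=
  opQhat P Pi - (opShat P Pi)^T *m invmx (opR P) *m opShat P Pi.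
Definition linear_p (P Pi : 'M[R]_n) (p : 'cV[R]_n) : 'cV[R]_n :=
  (hatA + cB L *m Thetabar_of P Pi)^T *m p
  + (hatC + cD L *m Thetabar_of P Pi)^T *m P *m csigma L
  + (Thetabar_of P Pi)^T *m cr L + Pi *m cb L + cq L.

Definition finite_horizon_solution (T : R) (P Pi : R -> 'M[R]_n)
    (p : R -> 'cV[R]_n) : Prop :=
  exists (dP dPi : R -> 'M[R]_n) (dp : R -> 'cV[R]_n),
  [/\ [/\ C1_on T P dP, C1_on T Pi dPi & C1_on T p dp],
      forall t, t \in `[0, T] -> possemidef_mx (P t) /\ possemidef_mx (Pi t),
      forall t, t \in `[0, T] ->
        [/\ dP t + riccatiP (P t) = 0,
            dPi t + riccatiPi (P t) (Pi t) = 0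
          & dp t + linear_p (P t) (Pi t) (p t) = 0]
    & [/\ P T = 0, Pi T = 0 & p T = 0]].

Definition algebraic_solution (P Pi : 'M[R]_n) (p : 'cV[R]_n) : Prop :=
  [/\ posdef_mx P, posdef_mx Pi
    & [/\ riccatiP P = 0, riccatiPi P Pi = 0 & linear_p P Pi p = 0]].

Definition H1 : Prop :=
  [/\ posdef_mx (cR L),
      posdef_mx (cQ L - (cS L)^T *m invmx (cR L) *m cS L)
    & posdef_mx (cQ L + cQbar L - (cS L)^T *m invmx (cR L) *m cS L)].

Definition H2 (d : measure_display) (Omega : measurableType d)
    (Pr : probability Omega R) (F : R -> set (set Omega))
    (W : R -> Omega -> R) : Prop :=
  ode_stabilizable (cA L + cAbar L) (cB L) /\
  L2_stabilizable Pr F W (cA L) (cB L) (cC L) (cD L).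

End Riccati.

(* Main.v *)
Require Import Defs.
From mathcomp Require Import all_boot all_order all_algebra.
From mathcomp Require Import all_classical all_reals all_analysis.
From mathcomp Require Import ring lra.
Import Order.TTheory GRing.Theory Num.Theory.
Import numFieldNormedType.Exports.
Local Open Scope classical_set_scope.
Local Open Scope ring_scope.

(** Completing the square turns a Riccati operator, for any gain [Th], into a
    Lyapunov operator with closed-loop matrices [A + B Th], [C + D Th], plus a
    cost, minus a square.  Taking for [Th] the stationary gain, the comparison
    principle for Lyapunov differential inequalities gives [P_T <= P] and
    [Pi_T <= Pi].  Taking the time-dependent gain instead, and using that the
    cost dominates [2 lam P], the same principle applied to
    [e^(-2 lam (T - t)) P - (P - P_T(t))], which vanishes at [T], gives
    [P - P_T(t) <= e^(-2 lam (T - t)) P], and likewise for [Pi].  Hence the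
    gains converge exponentially.  For [p], the error [e = p_T - p] solves a
    linear equation with an exponentially small source, and the principle
    applied to [phi ((k - 1) Pi_T + Pi) - e e^T], with [k] a large constant and
    [phi] a slow exponential, bounds [e]. *)

(** * One-sided derivatives on an interval *)

(** Independence of the horizon comes from the constants: they are built from the coefficients and
    the algebraic solution, starting from a lower bound [delta] for the two reduced costs and an
    upper bound [c] for [P] and [Pi]. In the second Riccati equation the drift is weighted by [Pi]
    but the diffusion by [P], so the difference of two solutions does not satisfy a closed Lyapunov
    inequality. For [p] the obstacle is that the error is driven by the finite-horizon closed loop,
    which is not close to the stationary one near the terminal time: the gain error is merely
    bounded there. The rank-one matrix [e e^T] is used because it evolves under the same Lyapunov
    operator as the weight, so the matrix principle bounds a vector without inverting the weight. It
    controls the square of the error, which halves the rate. *)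

Definition derive_within {R : realType} (T : R) (f : R -> R) (t df : R) : Prop :=
  (u - t)^-1 * (f u - f t) @[u --> within [set` `[0, T]] t^'] --> df.

(** Entrywise, so that each matrix rule reduces to the scalar one. *)
Definition mx_derive_within {R : realType} {k l : nat} (T : R)
    (F : R -> 'M[R]_(k, l)) (t : R) (dF : 'M[R]_(k, l)) : Prop :=
  forall i j, derive_within T (fun u => F u i j) t (dF i j).

Lemma derive_within_near {R : realType} {T : R} {f : R -> R} {t df e : R} :
  derive_within T f t df -> 0 < e ->
  \forall u \near t, u \in `[0, T] ->
    `|f u - f t - (u - t) * df| <= e * `|u - t|.
Proof.
move=> /cvgr_dist_le/[apply]; rewrite near_withinE /= => -[d /= d0 dP].
exists d => // u ud uT; have [->|ut] := eqVneq u t.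
  by rewrite !subrr mul0r subr0 normr0 mulr0.
have := dP u ud ut uT.
have ut0 : u - t != 0 by rewrite subr_eq0.
have -> : f u - f t - (u - t) * df
  = - ((u - t) * (df - (u - t)^-1 * (f u - f t))) by field.
by move=> H; rewrite normrN normrM mulrC; apply: ler_wpM2r.
Qed.

Lemma derive_within_cont {R : realType} {T : R} {f : R -> R} {t df : R} :
  derive_within T f t df -> f u @[u --> within [set` `[0, T]] t^'] --> f t.
Proof.
move=> fdf; have id_cvg : u - t @[u --> within [set` `[0, T]] t^'] --> 0.
  rewrite -(subrr t); apply: cvgB; last exact: cvg_cst.
  apply: (@cvg_trans _ t^'); first exact: cvg_within.
  exact: (@nbhs_dnbhs _ t).
have : (u - t) * ((u - t)^-1 * (f u - f t)) + f t
    @[u --> within [set` `[0, T]] t^'] --> 0 * df + f t.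
  by apply: cvgD; [exact: cvgM|exact: cvg_cst].
rewrite mul0r add0r; apply: cvg_trans; apply: near_eq_cvg.
rewrite near_withinE; near=> u => _ /=.
have ut0 : u - t != 0.
  by rewrite subr_eq0; near: u; exact: nbhs_dnbhs_neq.
by field.
Unshelve. all: by end_near. Qed.

Section DeriveWithin.
Context {R : realType} {T t : R}.
Implicit Types (f g : R -> R) (df dg c : R).
Local Notation D f df := (derive_within T f t df).

Lemma derive_within_cst c : D (fun=> c) 0.
Proof.
rewrite /derive_within (_ : (fun u => _) = cst 0) ?cvg_cst//; first exact: cvg_cst.
by apply/funext => u; rewrite subrr mulr0.
Qed.

Lemma derive_within_eq {f g df dg} : f =1 g -> df = dg -> D f df -> D g dg.
Proof. by move=> /funext -> ->. Qed.

Lemma derive_withinD {f g df dg} : D f df -> D g dg ->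
  D (fun u => f u + g u) (df + dg).
Proof.
move=> hf hg.
have : (u - t)^-1 * (f u - f t) + (u - t)^-1 * (g u - g t)
    @[u --> within [set` `[0, T]] t^'] --> df + dg by exact: cvgD.
by under eq_fun do rewrite -mulrDr addrACA -opprD.
Qed.

Lemma derive_withinM {f g df dg} : D f df -> D g dg ->
  D (fun u => f u * g u) (df * g t + f t * dg).
Proof.
move=> hf hg.
have : (u - t)^-1 * (f u - f t) * g u + f t * ((u - t)^-1 * (g u - g t))
    @[u --> within [set` `[0, T]] t^'] --> df * g t + f t * dg.
  apply: cvgD; apply: cvgM => //; last exact: cvg_cst.
  exact: derive_within_cont hg.
rewrite /derive_within.
suff -> : (fun u => (u - t)^-1 * (f u - f t) * g u
    + f t * ((u - t)^-1 * (g u - g t)))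
  = (fun u => (u - t)^-1 * (f u * g u - f t * g t)) by [].
by apply/funext => u; ring.
Qed.

Lemma derive_withinMl c {f df} : D f df -> D (fun u => c * f u) (c * df).
Proof.
by move=> hf; have := derive_withinM (derive_within_cst c) hf; rewrite mul0r add0r.
Qed.

Lemma derive_within_sum {I : finType} {F : I -> R -> R} {dF : I -> R} :
  (forall i, D (F i) (dF i)) -> D (fun u => \sum_i F i u) (\sum_i dF i).
Proof.
move=> hF; elim: (index_enum I) => [|i s IH].
  rewrite big_nil (_ : (fun u => _) = cst 0); first exact: derive_within_cst.
  by apply/funext => u; rewrite big_nil.
rewrite big_cons (_ : (fun u => _) = (fun u => F i u + \sum_(j <- s) F j u)).
  exact: derive_withinD.
by apply/funext => u; rewrite big_cons.
Qed.

Lemma derive_within_is_derive {f df} : is_derive t 1 f df -> D f df.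
Proof.
move=> [fd <-]; rewrite /derive_within.
have : h^-1 *: (f (h *: 1 + t) - f t) @[h --> 0^'] --> 'D_1 f t := fd.
move/cvgr_dist_le => hf; apply/cvgrPdist_le => e e0.
have [d /= d0 dP] := hf _ e0.
rewrite near_withinE; exists d => //= u ud ut _.
have := dP (u - t); rewrite /ball_ /= sub0r normrN distrC => /(_ ud).
by rewrite subr_eq0 => /(_ ut); rewrite /GRing.scale /= mulr1 subrK.
Qed.

Lemma derive_within_expR (c a : R) :
  D (fun u => expR (c * (a - u))) (- c * expR (c * (a - t))).
Proof.
apply: derive_within_is_derive.
have h : is_derive t 1 (fun u => c * (a - u)) (- c).
  apply: is_derive_eq.
  by rewrite /GRing.scale /= !(mulr0, mul0r, addr0, add0r, sub0r, mulrN, mulr1).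
rewrite mulrC.
exact: (@is_derive1_comp _ expR _ t _ _ (is_derive_expR _) h).
Qed.

End DeriveWithin.

Section MxDeriveWithin.
Context {R : realType} {T t : R}.
Local Notation D F dF := (mx_derive_within T F t dF).

Lemma mx_derive_withinP {k l} {F dF : R -> 'M[R]_(k, l)} :
  C1_on T F dF -> t \in `[0, T] -> D F (dF t).
Proof.
move=> [h _] /h ht i j; rewrite /derive_within.
have : ((u - t)^-1 *: (F u - F t)) i j @[u --> within [set` `[0, T]] t^']
    --> dF t i j.
  exact: (cvg_comp _ (fun M : 'M[R]_(k, l) => M i j) ht (@coord_continuous _ _ _ i j _)).
by under eq_fun do rewrite !mxE.
Qed.

Lemma mx_derive_within_cst {k l} (C : 'M[R]_(k, l)) : D (fun=> C) 0.
Proof. by move=> i j; rewrite mxE; exact: derive_within_cst. Qed.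

Lemma mx_derive_withinD {k l} {F G : R -> 'M[R]_(k, l)} {dF dG} :
  D F dF -> D G dG -> D (fun u => F u + G u) (dF + dG).
Proof.
move=> hF hG i j; apply: derive_within_eq (derive_withinD (hF i j) (hG i j)).
  by move=> u; rewrite mxE.
by rewrite mxE.
Qed.

Lemma mx_derive_withinZ {k l} {f : R -> R} {df} {F : R -> 'M[R]_(k, l)} {dF} :
  derive_within T f t df -> D F dF ->
  D (fun u => f u *: F u) (df *: F t + f t *: dF).
Proof.
move=> hf hF i j; apply: derive_within_eq (derive_withinM hf (hF i j)).
  by move=> u; rewrite mxE.
by rewrite !mxE.
Qed.

Lemma mx_derive_withinMl {k l} c {F : R -> 'M[R]_(k, l)} {dF} :
  D F dF -> D (fun u => c *: F u) (c *: dF).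
Proof.
move=> /(mx_derive_withinZ (derive_within_cst c)) h.
by move: h; rewrite scale0r add0r.
Qed.

Lemma mx_derive_withinB {k l} {F G : R -> 'M[R]_(k, l)} {dF dG} :
  D F dF -> D G dG -> D (fun u => F u - G u) (dF - dG).
Proof.
move=> hF /(mx_derive_withinMl (-1)) hG.
move=> i j; apply: derive_within_eq (mx_derive_withinD hF hG i j).
  by move=> u; rewrite scaleN1r.
by rewrite scaleN1r.
Qed.

Lemma mx_derive_within_tr {k l} {F : R -> 'M[R]_(k, l)} {dF} :
  D F dF -> D (fun u => (F u)^T) dF^T.
Proof.
move=> hF i j; apply: derive_within_eq (hF j i); last by rewrite mxE.
by move=> u; rewrite mxE.
Qed.

Lemma mx_derive_within_mul {k l m} {F : R -> 'M[R]_(k, l)} {G : R -> 'M[R]_(l, m)}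
    {dF dG} :
  D F dF -> D G dG -> D (fun u => F u *m G u) (dF *m G t + F t *m dG).
Proof.
move=> hF hG i j.
apply: derive_within_eq
  (derive_within_sum (fun s => derive_withinM (hF i s) (hG s j))).
  by move=> u; rewrite mxE.
by rewrite !mxE -big_split.
Qed.

End MxDeriveWithin.

(** Real induction downwards: the infimum of the [t] such that [Q] holds on all of [[t, T]] has the
    property by the limit hypothesis, and by the step hypothesis it cannot be positive. *)
Lemma interval_induction_down {R : realType} {T : R} {Q : R -> Prop} :
  0 < T -> Q T ->
  (forall t : R, 0 < t <= T -> Q t -> exists2 d, 0 < d &
     forall u : R, 0 <= u -> t - d < u <= t -> Q u) ->
  (forall t : R, 0 <= t < T -> (forall u : R, t < u <= T -> Q u) -> Q t) ->
  forall t : R, t \in `[0, T] -> Q t.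
Proof.
move=> T0 QT step lim.
pose S := [set t : R | 0 <= t <= T /\ forall u : R, t <= u <= T -> Q u].
have ST : S T.
  split; first by rewrite lexx ltW.
  by move=> u; rewrite -eq_le => /eqP <-.
have lbS : lbound S 0 by move=> t [/andP[]].
have hS : has_inf S by split; [exists T|exists 0].
have i0 : 0 <= inf S by apply: lb_le_inf => //; exists T.
have iT : inf S <= T by apply: ge_inf => //; exists 0.
have Qr u : inf S < u <= T -> Q u.
  move=> /andP[iu uT]; have ui : 0 < u - inf S by rewrite subr_gt0.
  have [v [_ vQ]] := inf_adherent ui hS; rewrite addrC subrK => vu.
  by apply: vQ; rewrite (ltW vu).
have Qi : Q (inf S).
  have [-> //|iT'] := eqVneq (inf S) T.
  by apply: lim => //; rewrite i0 lt_neqAle iT' iT.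
have Si : S (inf S).
  split; first by rewrite i0.
  move=> u /andP[]; rewrite le_eqVlt => /orP[/eqP <- //|iu uT].
  by apply: Qr; rewrite iu.
suff i0' : inf S = 0.
  by move=> t; rewrite in_itv /= => /andP[t0 tT]; case: Si => _; apply; rewrite i0' t0.
apply/eqP; rewrite eq_le i0 andbT leNgt; apply/negP => ip.
have [|d d0 dQ] := step _ _ Qi; first by rewrite ip.
pose v := Num.max 0 (inf S - d / 2).
have v0 : 0 <= v by rewrite le_max lexx.
have vi : v < inf S by rewrite gt_max ip /=; lra.
have dv : inf S - d < v by rewrite lt_max; apply/orP; right; lra.
have : S v.
  split; first by rewrite v0 (le_trans (ltW vi)).
  move=> u /andP[vu uT]; have [ui|iu] := leP u (inf S).
    by apply: dQ; [exact: le_trans vu|rewrite ui (lt_le_trans dv)].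
  by apply: Qr; rewrite iu.
move=> /(ge_inf (ex_intro _ 0 lbS)).
by rewrite leNgt vi.
Qed.

(** * Quadratic forms *)

Definition bform {R : realType} {k l : nat} (M : 'M[R]_(k, l))
  (x : 'cV[R]_k) (y : 'cV[R]_l) : R := (x^T *m M *m y) 0 0.

Notation qform M x := (bform M x x).
Notation sqnorm x := (bform 1%:M x x).

(** One norm for all shapes: it is submultiplicative, bounds quadratic forms, and dominates both the
    Frobenius and the Euclidean norm. *)
Definition l1norm {R : realType} {k l : nat} (M : 'M[R]_(k, l)) : R :=
  \sum_i \sum_j `|M i j|.

Section BilinearForms.
Context {R : realType}.

Lemma bform_sum {k l} (M : 'M[R]_(k, l)) x y :
  bform M x y = \sum_i \sum_j x i 0 * M i j * y j 0.
Proof.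
rewrite /bform mxE exchange_big /=; apply: eq_bigr => j _.
by rewrite mxE mulr_suml; apply: eq_bigr => i _; rewrite mxE.
Qed.

Lemma bformD {k l} (M N : 'M[R]_(k, l)) x y :
  bform (M + N) x y = bform M x y + bform N x y.
Proof. by rewrite /bform mulmxDr mulmxDl mxE. Qed.

Lemma bformN {k l} (M : 'M[R]_(k, l)) x y : bform (- M) x y = - bform M x y.
Proof. by rewrite /bform mulmxN mulNmx mxE. Qed.

Lemma bformB {k l} (M N : 'M[R]_(k, l)) x y :
  bform (M - N) x y = bform M x y - bform N x y.
Proof. by rewrite bformD bformN. Qed.

Lemma bformZ {k l} c (M : 'M[R]_(k, l)) x y : bform (c *: M) x y = c * bform M x y.
Proof. by rewrite /bform -scalemxAr -scalemxAl mxE. Qed.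

Lemma bform0 {k l} x y : bform (0 : 'M[R]_(k, l)) x y = 0.
Proof. by rewrite /bform mulmx0 mul0mx mxE. Qed.

Lemma bformDl {k l} (M : 'M[R]_(k, l)) x y z :
  bform M (x + y) z = bform M x z + bform M y z.
Proof. by rewrite /bform linearD !mulmxDl mxE. Qed.

Lemma bformDr {k l} (M : 'M[R]_(k, l)) x y z :
  bform M x (y + z) = bform M x y + bform M x z.
Proof. by rewrite /bform mulmxDr mxE. Qed.

Lemma bformZl {k l} (M : 'M[R]_(k, l)) c x z : bform M (c *: x) z = c * bform M x z.
Proof. by rewrite /bform linearZ /= -!scalemxAl mxE. Qed.

Lemma bformZr {k l} (M : 'M[R]_(k, l)) c x z : bform M x (c *: z) = c * bform M x z.
Proof. by rewrite /bform -scalemxAr mxE. Qed.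

Lemma bformr0 {k l} (M : 'M[R]_(k, l)) x : bform M x 0 = 0.
Proof. by rewrite /bform mulmx0 mxE. Qed.

Lemma bform_tr {k l} (M : 'M[R]_(k, l)) x y : bform M^T x y = bform M y x.
Proof.
rewrite !bform_sum exchange_big; apply: eq_bigr => i _; apply: eq_bigr => j _.
by rewrite mxE; ring.
Qed.

Lemma bform_mulr {k l m} (M : 'M[R]_(k, l)) (X : 'M[R]_(l, m)) x y :
  bform (M *m X) x y = bform M x (X *m y).
Proof. by rewrite /bform !mulmxA. Qed.

Lemma bform_mull {k l m} (M : 'M[R]_(k, l)) (X : 'M[R]_(k, m)) x y :
  bform (X^T *m M) x y = bform M (X *m x) y.
Proof. by rewrite /bform trmx_mul !mulmxA. Qed.

Lemma bform_congr {k l} (M : 'M[R]_k) (X : 'M[R]_(k, l)) x y :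
  bform (X^T *m M *m X) x y = bform M (X *m x) (X *m y).
Proof. by rewrite bform_mulr bform_mull. Qed.

Lemma bform_outer {k} (u v x y : 'cV[R]_k) :
  bform (u *m v^T) x y = bform 1%:M x u * bform 1%:M v y.
Proof.
rewrite /bform !mulmx1 !mulmxA -[_ *m v^T *m y]mulmxA.
rewrite -[x^T *m u *m (v^T *m y)]/(mulmx (x^T *m u) (v^T *m y)).
by rewrite [LHS]mxE big_ord1.
Qed.

Lemma bform1C {k} (x y : 'cV[R]_k) : bform 1%:M x y = bform 1%:M y x.
Proof. by rewrite -bform_tr trmx1. Qed.

Lemma bform_delta {k l} (M : 'M[R]_(k, l)) i j :
  bform M (delta_mx i 0) (delta_mx j 0) = M i j.
Proof. by rewrite /bform trmx_delta -rowE -colE !mxE. Qed.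

Lemma sqnormE {k} (x : 'cV[R]_k) : sqnorm x = \sum_i x i 0 ^+ 2.
Proof.
by rewrite /bform mulmx1 mxE; apply: eq_bigr => i _; rewrite mxE expr2.
Qed.

Lemma sqnorm_ge0 {k} (x : 'cV[R]_k) : 0 <= sqnorm x.
Proof. by rewrite sqnormE sumr_ge0 // => i _; exact: sqr_ge0. Qed.

Lemma sqr_entry_le {k} (x : 'cV[R]_k) i : x i 0 ^+ 2 <= sqnorm x.
Proof.
rewrite sqnormE (bigD1 i) //= lerDl sumr_ge0 // => j _; exact: sqr_ge0.
Qed.

Lemma l1norm_ge0 {k l} (M : 'M[R]_(k, l)) : 0 <= l1norm M.
Proof. by apply: sumr_ge0 => i _; apply: sumr_ge0 => j _. Qed.

Lemma l1norm_entry {k l} (M : 'M[R]_(k, l)) i j : `|M i j| <= l1norm M.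
Proof.
rewrite /l1norm (bigD1 i) //= (bigD1 j) //= -addrA lerDl addr_ge0 //.
  exact: sumr_ge0.
by apply: sumr_ge0 => ? _; apply: sumr_ge0.
Qed.

Lemma l1normD {k l} (M N : 'M[R]_(k, l)) : l1norm (M + N) <= l1norm M + l1norm N.
Proof.
rewrite /l1norm -big_split; apply: ler_sum => i _ /=.
rewrite -big_split; apply: ler_sum => j _ /=; rewrite mxE; exact: ler_normD.
Qed.

Lemma l1normN {k l} (M : 'M[R]_(k, l)) : l1norm (- M) = l1norm M.
Proof.
by apply: eq_bigr => i _; apply: eq_bigr => j _; rewrite mxE normrN.
Qed.

Lemma l1normZ {k l} c (M : 'M[R]_(k, l)) :
  l1norm (c *: M) = `|c| * l1norm M.
Proof.
rewrite /l1norm mulr_sumr; apply: eq_bigr => i _; rewrite mulr_sumr.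
by apply: eq_bigr => j _; rewrite mxE normrM.
Qed.

Lemma l1norm_tr {k l} (M : 'M[R]_(k, l)) : l1norm M^T = l1norm M.
Proof.
rewrite /l1norm exchange_big; apply: eq_bigr => i _; apply: eq_bigr => j _.
by rewrite mxE.
Qed.

Lemma l1norm_mul {k l m} (M : 'M[R]_(k, l)) (N : 'M[R]_(l, m)) :
  l1norm (M *m N) <= l1norm M * l1norm N.
Proof.
rewrite /l1norm mulr_suml; apply: ler_sum => i _.
apply: (@le_trans _ _ (\sum_j \sum_s `|M i s| * `|N s j|)).
  apply: ler_sum => j _; rewrite mxE (le_trans (ler_norm_sum _ _ _)) //.
  by apply: ler_sum => s _; rewrite normrM.
rewrite exchange_big mulr_suml; apply: ler_sum => s _ /=.
rewrite -mulr_sumr ler_wpM2l // (bigD1 s) //= lerDl.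
by apply: sumr_ge0 => ? _; apply: sumr_ge0.
Qed.

Lemma qform_le_l1norm {k} (M : 'M[R]_k) x : `|qform M x| <= l1norm M * sqnorm x.
Proof.
rewrite bform_sum (le_trans (ler_norm_sum _ _ _)) // /l1norm mulr_suml.
apply: ler_sum => i _; rewrite (le_trans (ler_norm_sum _ _ _)) // mulr_suml.
apply: ler_sum => j _; rewrite !normrM mulrAC [leRHS]mulrC ler_wpM2r //.
have := sqr_entry_le x i; have := sqr_entry_le x j.
rewrite -(real_normK (num_real (x i 0))) -(real_normK (num_real (x j 0))).
have := sqr_ge0 (`|x i 0| - `|x j 0|); nra.
Qed.

Lemma frobenius_le_l1norm {k l} (M : 'M[R]_(k, l)) : frobenius M <= l1norm M.
Proof.
rewrite /frobenius -[leRHS](ger0_norm (l1norm_ge0 M)) -sqrtr_sqr ler_wsqrtr //.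
rewrite expr2 {1}/l1norm mulr_suml; apply: ler_sum => i _.
rewrite mulr_suml; apply: ler_sum => j _.
by rewrite -(real_normK (num_real _)) expr2 ler_wpM2l // l1norm_entry.
Qed.

Lemma enorm_le_l1norm {k} (x : 'cV[R]_k) : enorm x <= l1norm x.
Proof.
apply: le_trans (frobenius_le_l1norm x); rewrite /enorm /frobenius.
by rewrite (eq_bigr (fun i => \sum_(j < 1) x i j ^+ 2)) // => i _; rewrite big_ord1.
Qed.

End BilinearForms.

(** * Comparison principle for Lyapunov differential inequalities *)

(** The generator of [dx = X x dt + Y x dW] applied to the form of [M], that is, the quadratic form
    of [M X + X^T M + Y^T M Y]. *)
Definition lyap {R : realType} {n : nat} (M X Y : 'M[R]_n) (x : 'cV[R]_n) : R :=
  bform M (X *m x) x + bform M x (X *m x) + qform M (Y *m x).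

Lemma lyapD {R : realType} {n : nat} (M N X Y : 'M[R]_n) (x : 'cV[R]_n) :
  lyap (M + N) X Y x = lyap M X Y x + lyap N X Y x.
Proof. by rewrite /lyap !bformD; ring. Qed.

Lemma lyapZ {R : realType} {n : nat} c (M X Y : 'M[R]_n) (x : 'cV[R]_n) :
  lyap (c *: M) X Y x = c * lyap M X Y x.
Proof. by rewrite /lyap !bformZ; ring. Qed.

Section Comparison.
Context {R : realType} {n : nat} {T : R} (T0 : 0 < T).
Implicit Types (G dG X Y : R -> 'M[R]_n).

Lemma mx_derive_within_near {G t dGt e} : mx_derive_within T G t dGt -> 0 < e ->
  exists2 d, 0 < d & forall u, u \in `[0, T] -> `|u - t| < d -> forall x,
    `|qform (G u) x - qform (G t) x - (u - t) * qform dGt x|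
      <= e * `|u - t| * sqnorm x.
Proof.
(* An error [e / N] per entry sums to at most [e]; the extra 1 keeps [N] positive when [n = 0]. *)
move=> dG e0; pose N : R := (n * n)%:R + 1.
have N0 : 0 < N by rewrite ltr_wpDl.
have eN0 : 0 < e / N by rewrite divr_gt0.
pose P i j u := u \in `[0, T] ->
  `|G u i j - G t i j - (u - t) * dGt i j| <= e / N * `|u - t|.
have : \forall u \near t, forall i j, P i j u.
  apply: (@filter_forall _ _ (fun i u => forall j, P i j u) _ (nbhs_filter t)) => i.
  apply: (@filter_forall _ _ (P i) _ (nbhs_filter t)) => j.
  exact: derive_within_near (dG i j) eN0.
move=> [d /= d0 dP]; exists d => // u uT ud x.
rewrite -bformZ -!bformB (le_trans (qform_le_l1norm _ _)) // ler_wpM2r ?sqnorm_ge0 //.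
rewrite distrC in ud.
apply: (@le_trans _ _ (\sum_(i < n) \sum_(j < n) (e / N * `|u - t|))).
  apply: ler_sum => i _; apply: ler_sum => j _; rewrite !mxE; exact: dP.
rewrite !sumr_const !card_ord -mulrnA -mulr_natr mulrAC ler_wpM2r //.
rewrite mulrAC ler_pdivrMr // ler_wpM2l ?(ltW e0) // /N; lra.
Qed.

(* No compactness of the sphere is needed: up to [O(h^2)], [G (t - h)] dominates
   [(1 + h X)^T G (1 + h X) + h Y^T G Y + h kappa], which is nonnegative, so
   nonnegativity propagates a little to the left of [t]. *)
Lemma comparison_strict {G dG X Y} {kappa : R -> R} :
  (forall x, 0 <= qform (G T) x) ->
  (forall t, t \in `[0, T] -> mx_derive_within T G t (dG t)) ->
  (forall t, t \in `[0, T] -> 0 < kappa t) ->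
  (forall t, t \in `[0, T] -> forall x,
     lyap (G t) (X t) (Y t) x + kappa t * sqnorm x <= - qform (dG t) x) ->
  forall t, t \in `[0, T] -> forall x, 0 <= qform (G t) x.
Proof.
move=> GT derG kappa0 hlyap; apply: interval_induction_down => //.
- move=> t /andP[t0 tT] Gt; have tI : t \in `[0, T] by rewrite in_itv /= ltW.
  have k0 := kappa0 t tI.
  have [d d0 dP] := mx_derive_within_near (derG t tI) (divr_gt0 k0 (ltr0Sn R 1)).
  pose c := l1norm ((X t)^T *m G t *m X t).
  have c0 : 0 <= c := l1norm_ge0 _.
  have c1 : 0 < 2 * (c + 1) by lra.
  (* Half of [kappa t] was spent on the derivative error; this bound on the step lets the other half
     absorb the second-order term [h^2 X^T G X]. *)
  exists (Num.min d (kappa t / (2 * (c + 1)))); first by rewrite lt_min d0 divr_gt0.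
  move=> u u0 /andP[ud ut] x.
  have uI : u \in `[0, T] by rewrite in_itv /= u0 (le_trans ut).
  pose h := t - u; have h0 : 0 <= h by rewrite subr_ge0.
  have hd : h < Num.min d (kappa t / (2 * (c + 1))) by rewrite /h; lra.
  move: hd; rewrite lt_min => /andP[hd hk].
  have hN : `|u - t| = h by rewrite distrC ger0_norm.
  have := dP u uI; rewrite hN => /(_ hd x) /ler_normlP[+ _].
  have := hlyap t tI x.
  have qX : bform (G t) (X t *m x) (X t *m x) <= c * sqnorm x.
    have /ler_normlP[_] := qform_le_l1norm ((X t)^T *m G t *m X t) x.
    by rewrite bform_congr.
  have := Gt (x + h *: (X t *m x)).
  rewrite bformDl !bformDr !bformZl !bformZr /lyap.
  have := Gt (Y t *m x).
  have s0 := sqnorm_ge0 x.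
  have hk2 : h * (2 * (c + 1)) <= kappa t by rewrite -ler_pdivlMr // ltW.
  have ehu : u - t = - h by rewrite /h; ring.
  rewrite ehu; move: hk2 s0 qX h0 c0; clear.
  set q := bform _ (_ *m x) (_ *m x).
  set s := bform 1%:M x x; set qy := bform _ (Y t *m x) (Y t *m x).
  set a := bform _ (X t *m x) x; set b := bform _ x (X t *m x).
  set g := bform _ x x; set dg := bform _ x x; set gu := bform _ x x.
  move: (kappa t) q s qy a b g gu dg c h => k q s qy a b g gu dg c h.
  move=> hk s0 qX h0 c0 qy0 H1 H2 H3.
  have : h * (a + b + qy + k * s) <= h * - dg by rewrite ler_wpM2l.
  have : h * h * q <= h * h * (c * s) by rewrite ler_wpM2l // mulr_ge0.
  have : h * qy >= 0 by rewrite mulr_ge0.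
  have : h * s * (h * (2 * (c + 1))) <= h * s * k by rewrite ler_wpM2l // mulr_ge0.
  have : h * s * h >= 0 by rewrite !mulr_ge0.
  nra.
- move=> t /andP[t0 tT] Gu x; have tI : t \in `[0, T] by rewrite in_itv /= t0 ltW.
  rewrite leNgt; apply/negP => q0.
  have [d d0 dP] := mx_derive_within_near (derG t tI) (ltr01 : 0 < 1 :> R).
  (* [N] bounds the slope at [x], error included, so over the length [h] the form regains at most
     half of its deficit and is still negative at [t + h]. *)
  pose N := `|qform (dG t) x| + sqnorm x + 1.
  have N0 : 0 < N by rewrite ltr_wpDl // addr_ge0 // sqnorm_ge0.
  pose h := Num.min (d / 2) (Num.min (T - t) (- qform (G t) x / (2 * N))).
  have h0 : 0 < h.
    rewrite !lt_min divr_gt0 //= subr_gt0 tT /= divr_gt0 // ?mulr_gt0 //; lra.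
  have hd : h < d by rewrite gt_min; apply/orP; left; lra.
  have hT : h <= T - t by rewrite !ge_min lexx !orbT.
  have hq : h * (2 * N) <= - qform (G t) x.
    by rewrite -ler_pdivlMr ?mulr_gt0 // !ge_min lexx !orbT.
  have uI : t + h \in `[0, T] by rewrite in_itv /=; lra.
  have := dP _ uI; rewrite addrAC subrr add0r (gtr0_norm h0) => /(_ hd x).
  have /Gu/(_ x) : t < t + h <= T by lra.
  move=> Gu0 /ler_normlP[_].
  have : h * qform (dG t) x <= h * `|qform (dG t) x|.
    by rewrite ler_wpM2l ?(ltW h0) // ler_norm.
  move: hq; rewrite /N; nra.
Qed.

(** Adding [e exp((c + 1)(T - s))] times the identity makes the inequality strict: the growth rate
    exceeds [c] by one, and this surplus is the margin [kappa]. Then [e] is made small. The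
    conclusion does not involve [c], so any crude bound on [X] and [Y] serves. *)
Lemma comparison {G dG X Y} {c : R} :
  (forall x, 0 <= qform (G T) x) ->
  (forall t, t \in `[0, T] -> mx_derive_within T G t (dG t)) ->
  (forall t, t \in `[0, T] -> forall x, lyap 1%:M (X t) (Y t) x <= c * sqnorm x) ->
  (forall t, t \in `[0, T] -> forall x,
     lyap (G t) (X t) (Y t) x <= - qform (dG t) x) ->
  forall t, t \in `[0, T] -> forall x, 0 <= qform (G t) x.
Proof.
move=> GT derG hc hlyap t tI x.
pose w e s := e * expR ((c + 1) * (T - s)).
have Ge e : 0 < e -> 0 <= qform (G t) x + w e t * sqnorm x.
  move=> e0; pose Ge s := G s + w e s *: (1%:M : 'M[R]_n).
  pose dGe s := dG s + (e * (- (c + 1) * expR ((c + 1) * (T - s)))) *: (1%:M : 'M[R]_n).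
  have w0 s : 0 < w e s by rewrite mulr_gt0 // expR_gt0.
  rewrite -bformZ -bformD.
  apply: (@comparison_strict Ge dGe X Y (w e)) => //.
  - by move=> y; rewrite bformD bformZ addr_ge0 // mulr_ge0 ?sqnorm_ge0 ?ltW.
  - move=> s sI; apply: mx_derive_withinD (derG s sI) _.
    have h := derive_withinMl e (@derive_within_expR R T s (c + 1) T).
    have := mx_derive_withinZ h (mx_derive_within_cst (1%:M : 'M[R]_n)).
    by rewrite scaler0 addr0.
  - move=> s sI y; rewrite lyapD lyapZ bformD bformZ.
    have := hlyap s sI y; have := hc s sI y.
    rewrite /w; move: (expR_gt0 ((c + 1) * (T - s))) e0.
    set E := expR _ => E0 e0 /(ler_wpM2l (ltW (mulr_gt0 e0 E0))) hc' hl.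
    nra.
rewrite leNgt; apply/negP => q0.
(* With [e] equal to the deficit divided by [2 W], the perturbation restores less than half of the
   deficit. *)
pose W := expR ((c + 1) * (T - t)) * sqnorm x + 1.
have W0 : 0 < W by rewrite ltr_wpDl // mulr_ge0 ?sqnorm_ge0 // expR_ge0.
have := Ge (- qform (G t) x / (2 * W)).
rewrite divr_gt0 ?mulr_gt0 // ?oppr_gt0 // => /(_ erefl).
rewrite /w -mulrA.
have : - qform (G t) x / (2 * W) * (2 * W) = - qform (G t) x.
  by rewrite mulfVK // gt_eqF // mulr_gt0.
have : 0 < - qform (G t) x / (2 * W) by rewrite divr_gt0 ?mulr_gt0 // ?oppr_gt0.
rewrite {3}/W; set z := _ / _; set v := _ * sqnorm x; nra.
Qed.

End Comparison.

(** * Coercive matrices and uniform closeness to a constant *)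

Section Coercive.
Context {R : realType}.

Lemma coercive_unitmx {n} {M : 'M[R]_n} {r : R} :
  0 < r -> (forall x, r * sqnorm x <= qform M x) -> M \in unitmx.
Proof.
move=> r0 rM; rewrite unitmxE unitfE; apply/negP => /det0P[v v0 vM].
have := rM v^T; rewrite {2}/bform trmxK vM mul0mx mxE pmulr_rle0 // sqnormE => h.
case/negP: v0; apply/eqP/rowP => j; rewrite mxE.
have /eqP : \sum_i v^T i 0 ^+ 2 = 0.
  by apply/eqP; rewrite eq_le h sumr_ge0 // => i _; exact: sqr_ge0.
rewrite psumr_eq0 => [|i _]; last exact: sqr_ge0.
by move=> /allP/(_ j); rewrite mem_index_enum mxE sqrf_eq0 => /(_ erefl)/eqP.
Qed.

(** The [j]-th column [y] of the inverse satisfies [r |y|^2 <= y^T M y = y_j], so each of its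
    entries is at most [1 / r] in absolute value. *)
Lemma coercive_invmx_le {n} {M : 'M[R]_n} {r : R} :
  0 < r -> (forall x, r * sqnorm x <= qform M x) -> l1norm (invmx M) <= (n * n)%:R / r.
Proof.
move=> r0 rM; have Mu := coercive_unitmx r0 rM.
have ent i j : `|invmx M i j| <= r^-1.
  pose y := invmx M *m delta_mx j (0 : 'I_1).
  have yE s : y s 0 = invmx M s j by rewrite /y -colE mxE.
  have /= := rM y; rewrite {2}/bform -mulmxA mulKVmx //.
  have -> : (y^T *m delta_mx j (0 : 'I_1)) 0 0 = y j 0 by rewrite -colE !mxE.
  rewrite -yE => h.
  have yj := sqr_entry_le y j; have yi := sqr_entry_le y i.
  have hj : y j 0 <= r^-1.
    have h0 : 0 <= y j 0.
      by apply: le_trans h; rewrite mulr_ge0 ?sqnorm_ge0 ?ltW.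
    rewrite -(ler_pM2l r0) divff ?gt_eqF //.
    have [y0|y0] := eqVneq (y j 0) 0; first by rewrite y0 mulr0 ler01.
    have yp : 0 < y j 0 by rewrite lt_neqAle eq_sym y0.
    rewrite -(ler_pM2r yp) mul1r; apply: le_trans h.
    by rewrite -mulrA -expr2 ler_pM2l.
  rewrite -(@ler_pXn2r _ 2) ?nnegrE ?invr_ge0 ?(ltW r0) // real_normK ?num_real //.
  apply: le_trans yi _; rewrite -(ler_pM2l r0); apply: le_trans h _.
  by rewrite expr2 mulrA divff ?gt_eqF // mul1r.
apply: (@le_trans _ _ (\sum_(i < n) \sum_(j < n) r^-1)).
  by apply: ler_sum => i _; apply: ler_sum => j _.
by rewrite !sumr_const !card_ord -mulrnA mulr_natl.
Qed.

(** Instead of compactness of the sphere: for [y = M^-1 x] and [c] above the norm of [M^-1],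
    nonnegativity of the form at [x - y / c] gives [x^T M x >= |x|^2 / c]. *)
Lemma posdef_coercive {n} {M : 'M[R]_n} :
  posdef_mx M -> exists2 r, 0 < r & forall x, r * sqnorm x <= qform M x.
Proof.
move=> [Ms Mp].
have Mu : M \in unitmx.
  rewrite unitmxE unitfE; apply/negP => /det0P[v v0 vM].
  have := Mp v^T; rewrite trmxK vM mul0mx mxE ltxx => H.
  have : v^T != 0 by apply: contraNneq v0 => /(congr1 trmx); rewrite trmxK trmx0 => ->.
  by move=> /H.
have M0 x : 0 <= qform M x.
  by have [->|/Mp/ltW //] := eqVneq x 0; rewrite bformr0.
pose c := l1norm (invmx M) + 1.
have c0 : 0 < c by rewrite ltr_wpDl // l1norm_ge0.
exists c^-1 => [|x]; first by rewrite invr_gt0.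
pose y := invmx M *m x.
have yx : qform M y <= c * sqnorm x.
  rewrite {1}/y -bform_mulr mulmxV // bform1C /y -bform_mulr mul1mx.
  have /ler_normlP[_] := qform_le_l1norm (invmx M) x.
  by move=> /le_trans; apply; rewrite ler_wpM2r ?sqnorm_ge0 // /c lerDl.
have bxy : bform M x y = sqnorm x by rewrite /y -bform_mulr mulmxV.
have byx : bform M y x = sqnorm x by rewrite -bform_tr Ms.
have := M0 (x - c^-1 *: y).
rewrite -scaleNr bformDl !bformDr !bformZl !bformZr bxy byx.
have := ler_wpM2l (sqr_ge0 c^-1) yx.
have -> : c^-1 ^+ 2 * (c * sqnorm x) = c^-1 * sqnorm x by field; rewrite gt_eqF.
by move: (c^-1) (sqnorm x) (qform M x) (qform M y) => *; lra.
Qed.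

End Coercive.

(* [M i = M0 + O(w i)], uniformly in [i]. *)
Definition near_const {R : realType} {I : Type} (w : I -> R) {k l : nat}
    (M : I -> 'M[R]_(k, l)) (M0 : 'M[R]_(k, l)) : Prop :=
  exists K, forall i, l1norm (M i - M0) <= K * w i.

Section NearConst.
Context {R : realType} {I : Type} {w : I -> R} (w01 : forall i, 0 <= w i <= 1).
Local Notation near := (near_const w).

Lemma near_const_pos {k l} {M : I -> 'M[R]_(k, l)} {M0} : near M M0 ->
  exists2 K, 0 <= K & forall i, l1norm (M i - M0) <= K * w i.
Proof.
move=> [K MK]; exists `|K| => // i; apply: le_trans (MK i) _.
by rewrite ler_wpM2r ?ler_norm //; case/andP: (w01 i).
Qed.

Lemma near_const_bounded {k l} {M : I -> 'M[R]_(k, l)} {M0} : near M M0 ->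
  exists K, forall i, l1norm (M i) <= K.
Proof.
move=> /near_const_pos[K K0 MK]; exists (K + l1norm M0) => i.
rewrite -[M i](subrK M0) (le_trans (l1normD _ _)) // lerD2r.
apply: le_trans (MK i) _; rewrite -[leRHS]mulr1 ler_wpM2l //.
by case/andP: (w01 i).
Qed.

Lemma near_const_cst {k l} (M0 : 'M[R]_(k, l)) : near (fun=> M0) M0.
Proof.
exists 0 => i; rewrite subrr mul0r /l1norm big1 // => j _; rewrite big1 // => s _.
by rewrite mxE normr0.
Qed.

Lemma near_constD {k l} {M N : I -> 'M[R]_(k, l)} {M0 N0} :
  near M M0 -> near N N0 -> near (fun i => M i + N i) (M0 + N0).
Proof.
move=> [K MK] [H NH]; exists (K + H) => i.
by rewrite opprD addrACA (le_trans (l1normD _ _)) // mulrDl lerD.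
Qed.

Lemma near_constN {k l} {M : I -> 'M[R]_(k, l)} {M0} :
  near M M0 -> near (fun i => - M i) (- M0).
Proof. by move=> [K MK]; exists K => i; rewrite -opprD l1normN. Qed.

Lemma near_const_tr {k l} {M : I -> 'M[R]_(k, l)} {M0} :
  near M M0 -> near (fun i => (M i)^T) M0^T.
Proof. by move=> [K MK]; exists K => i; rewrite -linearB l1norm_tr. Qed.

Lemma near_constM {k l m} {M : I -> 'M[R]_(k, l)} {N : I -> 'M[R]_(l, m)} {M0 N0} :
  near M M0 -> near N N0 -> near (fun i => M i *m N i) (M0 *m N0).
Proof.
move=> /[dup] /near_const_bounded[L ML] /near_const_pos[K K0 MK].
move=> /near_const_pos[H H0 NH].
exists (L * H + K * l1norm N0) => i.
have -> : M i *m N i - M0 *m N0 = M i *m (N i - N0) + (M i - M0) *m N0.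
  by rewrite mulmxBr mulmxBl addrA subrK.
rewrite (le_trans (l1normD _ _)) // mulrDl lerD // (le_trans (l1norm_mul _ _)) //.
  by rewrite -mulrA ler_pM ?l1norm_ge0.
by rewrite mulrAC ler_wpM2r ?l1norm_ge0.
Qed.

(** By the identity [M^-1 - M0^-1 = - M^-1 (M - M0) M0^-1], where common coercivity bounds the first
    factor uniformly. *)
Lemma near_const_invmx {n} {M : I -> 'M[R]_n} {M0} {r : R} : 0 < r ->
  (forall i x, r * sqnorm x <= qform (M i) x) ->
  (forall x, r * sqnorm x <= qform M0 x) ->
  near M M0 -> near (fun i => invmx (M i)) (invmx M0).
Proof.
move=> r0 rM rM0 /near_const_pos[K K0 MK].
exists ((n * n)%:R / r * K * l1norm (invmx M0)) => i.
have Mu := coercive_unitmx r0 (rM i); have M0u := coercive_unitmx r0 rM0.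
have -> : invmx (M i) - invmx M0 = - (invmx (M i) *m (M i - M0) *m invmx M0).
  by rewrite mulmxBr mulmxBl mulVmx // mul1mx mulmxK // opprB.
rewrite l1normN (le_trans (l1norm_mul _ _)) // [leRHS]mulrAC.
rewrite ler_wpM2r ?l1norm_ge0 // (le_trans (l1norm_mul _ _)) // -[leRHS]mulrA.
by rewrite ler_pM ?l1norm_ge0 ?(coercive_invmx_le r0 (rM i)).
Qed.

(** Turns bounds on forms into bounds on entries. Nonnegativity of the difference at [es + et] and
    [es - et] bounds its off-diagonal entries by its diagonal ones, which the upper bound
    controls. *)
Lemma near_const_sandwich {n} {M : I -> 'M[R]_n} {M0} : M0^T = M0 ->
  (forall i, (M i)^T = M i) ->
  (forall i x, 0 <= qform (M0 - M i) x) ->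
  (forall i x, qform (M0 - M i) x <= w i * qform M0 x) ->
  near M M0.
Proof.
move=> M0s Ms lo up.
exists (\sum_i \sum_j (M0 i i + M0 j j)) => i.
rewrite -l1normN opprB /l1norm mulr_suml; apply: ler_sum => s _.
rewrite mulr_suml; apply: ler_sum => t _.
pose es : 'cV[R]_n := delta_mx s 0; pose et : 'cV[R]_n := delta_mx t 0.
have := up i es; have := up i et; have := lo i es; have := lo i et.
have := lo i (es + et); have := lo i (es - et).
rewrite -(scaleN1r et) !bformDl !bformDr !bformZl !bformZr !bform_delta.
have -> : (M0 - M i) t s = (M0 - M i) s t.
  by rewrite -{1}M0s -{1}(Ms i) -linearB mxE.
by move=> *; apply/ler_normlP; split; lra.
Qed.

End NearConst.

(** * Riccati operators *)

Section RiccatiOperator.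
Context {R : realType} {n m : nat}.
Variables (A C Q : 'M[R]_n) (B D : 'M[R]_(n, m)) (S : 'M[R]_(m, n)) (R0 : 'M[R]_m).

Definition crossS (P Pi : 'M[R]_n) : 'M[R]_(m, n) :=
  B^T *m Pi + D^T *m P *m C + S.
Definition weightR (P : 'M[R]_n) : 'M[R]_m := R0 + D^T *m P *m D.
Definition gain (P Pi : 'M[R]_n) : 'M[R]_(m, n) :=
  - (invmx (weightR P) *m crossS P Pi).
(* [riccatiP L P] is the diagonal case [ricc P P] with the plain coefficients, and
   [riccatiPi L P Pi] is [ricc P Pi] with the hatted ones. *)
Definition ricc (P Pi : 'M[R]_n) : 'M[R]_n :=
  Pi *m A + A^T *m Pi + C^T *m P *m C + Q
  - (crossS P Pi)^T *m invmx (weightR P) *m crossS P Pi.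

Definition cost (x : 'cV[R]_n) (u : 'cV[R]_m) : R :=
  qform Q x + 2 * bform S u x + qform R0 u.

Hypothesis R0s : R0^T = R0.

Lemma weightR_tr P : P^T = P -> (weightR P)^T = weightR P.
Proof. by move=> Ps; rewrite /weightR linearD /= !trmx_mul trmxK R0s Ps mulmxA. Qed.

(** [ricc] is the minimum over the control of drift, diffusion and cost terms, attained by [gain];
    another feedback [Th] overshoots it by the [weightR] square of the deviation. *)
Lemma ricc_complete_square (Th : 'M[R]_(m, n)) {P Pi} x :
  P^T = P -> Pi^T = Pi -> weightR P \in unitmx ->
  qform (ricc P Pi) x
  = bform Pi ((A + B *m Th) *m x) x + bform Pi x ((A + B *m Th) *m x)
    + qform P ((C + D *m Th) *m x) + cost x (Th *m x)
    - qform (weightR P) (Th *m x - gain P Pi *m x).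
Proof.
move=> Ps Pis Ru.
have symP k (M : 'M[R]_k) y z : M^T = M -> bform M y z = bform M z y.
  by move=> {1}<-; rewrite bform_tr.
have Rs := weightR_tr _ Ps; pose s := crossS P Pi *m x.
have Rv y : bform (weightR P) y (gain P Pi *m x) = - bform 1%:M y s.
  rewrite -bform_mulr /gain mulmxN mulmxA mulmxV // mul1mx bformN.
  by rewrite -[in RHS]bform_mulr mul1mx.
have vv : bform 1%:M (gain P Pi *m x) s = - qform (invmx (weightR P)) s.
  by rewrite bform1C /gain mulNmx -mulmxA -scaleN1r bformZr -bform_mulr mul1mx mulN1r.
rewrite !mulmxDl -!mulmxA; set u := Th *m x.
have us : bform 1%:M u s
    = bform Pi (B *m u) x + bform P (D *m u) (C *m x) + bform S u x.
  by rewrite /s -bform_mulr mul1mx /crossS !bformD -mulmxA !bform_mull bform_mulr.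
rewrite -(scaleN1r (gain P Pi *m x)) !bformDl !bformDr !bformZl !bformZr.
rewrite (symP _ _ (gain P Pi *m x)) // !Rv vv us.
rewrite /ricc /cost bformB !bformD !bform_congr -/s bform_mulr bform_mull.
rewrite (symP _ _ x (B *m u)) // (symP _ _ (D *m u) (C *m x)) //; ring.
Qed.

Hypothesis R0pos : posdef_mx R0.

(** The minimum over the control, at [u = - R0^-1 S x], is the form of the Schur complement. *)
Lemma cost_ge (x : 'cV[R]_n) (u : 'cV[R]_m) :
  qform (Q - S^T *m invmx R0 *m S) x <= cost x u.
Proof.
have [r r0 rR] := posdef_coercive R0pos; have Ru := coercive_unitmx r0 rR.
pose v := invmx R0 *m (S *m x).
have Rv y : bform R0 y v = bform S y x.
  by rewrite /v -bform_mulr mulmxV // -bform_mulr mul1mx.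
have vR y : bform R0 v y = bform S y x by rewrite -bform_tr R0s.
have : 0 <= qform R0 (u + v).
  by apply: le_trans (rR _); rewrite mulr_ge0 ?sqnorm_ge0 ?ltW.
rewrite bformDl !bformDr !Rv vR /cost bformB bform_congr.
have -> : bform S v x = bform (invmx R0) (S *m x) (S *m x).
  have -> : bform S v x = bform 1%:M v (S *m x) by rewrite -bform_mulr mul1mx.
  by rewrite bform1C /v -(bform_mulr 1%:M) mul1mx.
lra.
Qed.

Lemma weightR_coercive {r : R} {P} : (forall x, r * sqnorm x <= qform R0 x) ->
  (forall x, 0 <= qform P x) -> forall x, r * sqnorm x <= qform (weightR P) x.
Proof.
by move=> rR P0 x; rewrite /weightR bformD bform_congr ler_wpDr.
Qed.

Lemma weightR_unitmx {P} : (forall x, 0 <= qform P x) -> weightR P \in unitmx.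
Proof.
move=> P0; have [r r0 rR] := posdef_coercive R0pos.
exact: coercive_unitmx r0 (weightR_coercive rR P0).
Qed.

Lemma weightR_ge0 {P} u : (forall x, 0 <= qform P x) -> 0 <= qform (weightR P) u.
Proof.
move=> P0; have [r r0 rR] := posdef_coercive R0pos.
apply: le_trans (weightR_coercive rR P0 u).
by rewrite mulr_ge0 ?sqnorm_ge0 ?ltW.
Qed.

(** * Inequalities between a stationary pair and an arbitrary one *)

Section Pair.
Variables (P Pi P1 Pi1 : 'M[R]_n).
Hypotheses (Ps : P^T = P) (Pis : Pi^T = Pi) (P0 : forall x, 0 <= qform P x).
Hypotheses (P1s : P1^T = P1) (Pi1s : Pi1^T = Pi1) (P10 : forall x, 0 <= qform P1 x).
Hypothesis ricc0 : ricc P Pi = 0.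

(** With the stationary gain in both identities the costs cancel, and only the square of the pair
    [P1], [Pi1] remains, with a favourable sign. *)
Lemma ricc_lower x (X := A + B *m gain P Pi) (Y := C + D *m gain P Pi) :
  bform (Pi - Pi1) (X *m x) x + bform (Pi - Pi1) x (X *m x)
    + qform (P - P1) (Y *m x) <= - qform (ricc P1 Pi1) x.
Proof.
have := ricc_complete_square (gain P Pi) x Ps Pis (weightR_unitmx P0).
have := ricc_complete_square (gain P Pi) x P1s Pi1s (weightR_unitmx P10).
have := weightR_ge0 (gain P Pi *m x - gain P1 Pi1 *m x) P10.
by rewrite ricc0 subrr bform0 bformr0 !bformB; lra.
Qed.

Section Upper.
Variable x : 'cV[R]_n.
Let X := A + B *m gain P1 Pi1.
Let Y := C + D *m gain P1 Pi1.
Let E := gain P1 Pi1 - gain P Pi.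

Let ricc1_eq : qform (ricc P1 Pi1) x
  = bform Pi1 (X *m x) x + bform Pi1 x (X *m x) + qform P1 (Y *m x)
    + cost x (gain P1 Pi1 *m x).
Proof.
rewrite (ricc_complete_square (gain P1 Pi1) x P1s Pi1s (weightR_unitmx P10)).
by rewrite subrr bformr0 subr0.
Qed.

Let ricc_eq : 0
  = bform Pi (X *m x) x + bform Pi x (X *m x) + qform P (Y *m x)
    + cost x (gain P1 Pi1 *m x) - qform (weightR P) (E *m x).
Proof.
rewrite -(bform0 x x) -ricc0 mulmxBl.
exact: (ricc_complete_square (gain P1 Pi1) x Ps Pis (weightR_unitmx P0)).
Qed.

(** With the gain of [P1], [Pi1], the square sits on the stationary side and enters with the factor
    [1 - a >= 0]. The costs cancel up to [a * cost], which later pays for the derivative of the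
    exponential weight. *)
Lemma ricc_upper a : a <= 1 ->
  bform (Pi1 - (1 - a) *: Pi) (X *m x) x + bform (Pi1 - (1 - a) *: Pi) x (X *m x)
    + qform (P1 - (1 - a) *: P) (Y *m x) + a * cost x (gain P1 Pi1 *m x)
  <= qform (ricc P1 Pi1) x.
Proof.
move=> a1; rewrite ricc1_eq !bformB !bformZ.
have a0 : 0 <= 1 - a by rewrite subr_ge0.
have := mulr_ge0 a0 (weightR_ge0 (E *m x) P0).
have := congr1 ( *%R (1 - a)) ricc_eq; rewrite mulr0.
by move=> h1 h2; lra.
Qed.

(** The sum of [k - 1] copies of the identity for [Pi1] and one for [Pi]. The costs add up to [k]
    copies against a single squared gain error; the nonnegative diffusion terms are discarded, since
    the error of [p] follows an equation without diffusion. *)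
Lemma ricc_mixed k : 1 <= k ->
  bform ((k - 1) *: Pi1 + Pi) (X *m x) x + bform ((k - 1) *: Pi1 + Pi) x (X *m x)
    + k * cost x (gain P1 Pi1 *m x) - qform (weightR P) (E *m x)
  <= (k - 1) * qform (ricc P1 Pi1) x.
Proof.
move=> k1; rewrite ricc1_eq !(bformD _ Pi) !bformZ.
have k0 : 0 <= k - 1 by rewrite subr_ge0.
have := mulr_ge0 k0 (P10 (Y *m x)); have := P0 (Y *m x).
by move: ricc_eq => h1 h2 h3; lra.
Qed.

End Upper.
End Pair.

(** * Continuity of the gains in the Riccati solutions *)

Section Near.
Context {I : Type} {w : I -> R} (w01 : forall i, 0 <= w i <= 1).
Variables (Pf Pif : I -> 'M[R]_n) (P Pi : 'M[R]_n).
Hypothesis (nP : near_const w Pf P) (nPi : near_const w Pif Pi).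
Hypotheses (Pf0 : forall i x, 0 <= qform (Pf i) x) (P0 : forall x, 0 <= qform P x).

Lemma near_invR :
  near_const w (fun i => invmx (weightR (Pf i))) (invmx (weightR P)).
Proof.
have [r r0 rR] := posdef_coercive R0pos.
apply: (near_const_invmx w01 r0).
- by move=> i x; exact: weightR_coercive.
- by move=> x; exact: weightR_coercive.
- apply: (near_constD (near_const_cst _)).
  exact: (near_constM w01 (near_constM w01 (near_const_cst _) nP) (near_const_cst _)).
Qed.

Lemma near_gain :
  near_const w (fun i => gain (Pf i) (Pif i)) (gain P Pi).
Proof.
have nS : near_const w (fun i => crossS (Pf i) (Pif i)) (crossS P Pi).
  apply: (near_constD _ (near_const_cst _)).
  apply: (near_constD (near_constM w01 (near_const_cst _) nPi)).
  exact: (near_constM w01 (near_constM w01 (near_const_cst _) nP) (near_const_cst _)).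
exact: (near_constN (near_constM w01 near_invR nS)).
Qed.

End Near.
End RiccatiOperator.

(** * Exponential convergence of the solutions *)

(** Supplies the growth constant that [comparison] asks for. *)
Lemma lyap1_le {R : realType} {n} {X Y : 'M[R]_n} {K H : R} x :
  l1norm X <= K -> l1norm Y <= H -> lyap 1%:M X Y x <= (2 * K + H ^+ 2) * sqnorm x.
Proof.
move=> XK YH; have s0 := sqnorm_ge0 x.
rewrite /lyap (bform1C (X *m x)) -bform_mulr mul1mx -bform_congr mulmx1.
have /ler_normlP[_ hX] := qform_le_l1norm X x.
have /ler_normlP[_ hY] := qform_le_l1norm (Y^T *m Y) x.
have hY2 : l1norm (Y^T *m Y) <= H ^+ 2.
  rewrite (le_trans (l1norm_mul _ _)) // l1norm_tr -expr2.
  by rewrite lerXn2r ?nnegrE ?l1norm_ge0 // (le_trans (l1norm_ge0 _) YH).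
have := ler_wpM2r s0 XK; have := ler_wpM2r s0 hY2.
by move=> *; lra.
Qed.

(** * Lower and upper bounds for a Riccati flow *)

Section Bounds.
Context {R : realType} {n m : nat}.
Variables (A C Q : 'M[R]_n) (B D : 'M[R]_(n, m)) (S : 'M[R]_(m, n)) (R0 : 'M[R]_m).
Hypotheses (R0s : R0^T = R0) (R0pos : posdef_mx R0).
Local Notation ricc := (ricc A C Q B D S R0).
Local Notation gain := (gain C B D S R0).

Variables (T lam : R) (P Pi : 'M[R]_n) (Pf Pif : R -> 'M[R]_n).
Hypothesis T0 : 0 < T.
Let a t : R := expR (- (2 * lam) * (T - t)).

Hypotheses (Ps : P^T = P) (Pis : Pi^T = Pi).
Hypotheses (P0 : forall x, 0 <= qform P x) (Pi0 : forall x, 0 <= qform Pi x).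
Hypotheses (ricc0 : ricc P Pi = 0).
Hypothesis lam0 : 0 <= lam.
Hypothesis lamPi : forall x,
  2 * lam * qform Pi x <= qform (Q - S^T *m invmx R0 *m S) x.
Hypothesis psd : forall t, t \in `[0, T] ->
  possemidef_mx (Pf t) /\ possemidef_mx (Pif t).
Hypothesis flow : forall t, t \in `[0, T] ->
  mx_derive_within T Pif t (- ricc (Pf t) (Pif t)).
Hypothesis PifT : Pif T = 0.

(* Either the equation for [Pi] is the one for [P] itself, or the bounds on [P]
   are already known. *)
Hypothesis coupling : (P = Pi /\ Pf = Pif) \/
  forall t, t \in `[0, T] -> forall x,
    0 <= qform (P - Pf t) x <= a t * qform P x.

Lemma riccati_lower t : t \in `[0, T] -> forall x, 0 <= qform (Pi - Pif t) x.
Proof.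
(* The factor [b] rescales the diffusion matrix to treat both couplings at once: [b = 1] keeps the
   diffusion term when the two matrices agree, and [b = 0] drops it when [P - Pf] is already known
   to be nonnegative. *)
have [b hb] : exists b : R, forall t, t \in `[0, T] -> forall y,
    qform (Pi - Pif t) (b *: y) <= qform (P - Pf t) y.
  case: coupling => [[<- <-]|h]; first by exists 1 => *; rewrite scale1r.
  by exists 0 => s sI y; rewrite scale0r bformr0; case/andP: (h s sI y).
pose X := A + B *m gain P Pi; pose Y := b *: (C + D *m gain P Pi).
apply: (@comparison _ _ _ T0 (fun t => Pi - Pif t)
  (fun t => ricc (Pf t) (Pif t)) (fun=> X) (fun=> Y) (2 * l1norm X + l1norm Y ^+ 2)).
- by move=> x; rewrite PifT subr0.
- move=> s sI; have := mx_derive_withinB (mx_derive_within_cst Pi) (flow _ sI).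
  by rewrite opprK add0r.
- by move=> s sI x; exact: lyap1_le.
- move=> s sI x; have [[Pfs Pf0] [Pifs Pif0]] := psd _ sI.
  apply: le_trans (@ricc_lower _ _ _ A C Q B D S R0 R0s R0pos P Pi (Pf s) (Pif s)
    Ps Pis P0 Pfs Pifs Pf0 ricc0 x).
  by rewrite /lyap lerD2l /Y -scalemxAl hb.
Qed.

Lemma riccati_upper t : t \in `[0, T] -> forall x,
  qform (Pi - Pif t) x <= a t * qform Pi x.
Proof.
have Plow s : s \in `[0, T] -> forall x, 0 <= qform (P - Pf s) x.
  move=> sI x; case: coupling => [[-> ->]|h]; first exact: riccati_lower.
  by case/andP: (h s sI x).
have a01 s : s \in `[0, T] -> 0 <= a s <= 1.
  rewrite in_itv /= => /andP[_ sT]; rewrite /a expR_ge0 -expR0 ler_expR /=.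
  by rewrite mulNr oppr_le0 mulr_ge0 ?mulr_ge0 // subr_ge0.
pose G s := a s *: Pi + (Pif s - Pi).
have [b hb] : exists b : R, forall t, t \in `[0, T] -> forall y,
    qform (G t) (b *: y) <= qform (Pf t - (1 - a t) *: P) y.
  case: coupling => [[PE PfE]|h].
    exists 1 => s sI y; rewrite scale1r /G -PE -PfE !(bformD, bformN, bformZ); lra.
  exists 0 => s sI y; rewrite scale0r bformr0.
  have /andP[_] := h s sI y; rewrite !bformB bformZ; lra.
(* Closeness with the constant weight 1 is just boundedness: since [Pif] lies between 0 and [Pi],
   and [Pf] between 0 and [P], the gains are bounded over the interval, as [comparison] requires of
   the closed-loop matrices. *)
pose I := {s : R | s \in `[0, T]}.
have w01 (i : I) : 0 <= (1 : R) <= 1 by rewrite ler01 lexx.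
have nP : near_const (fun=> 1) (fun i : I => Pf (sval i)) P.
  apply: near_const_sandwich => // -[s sI] /=; first by case: (psd _ sI) => -[].
    exact: Plow.
  by move=> x; rewrite mul1r bformB gerBl; case: (psd _ sI) => -[_ /(_ x)].
have nPi : near_const (fun=> 1) (fun i : I => Pif (sval i)) Pi.
  apply: near_const_sandwich => // -[s sI] /=; first by case: (psd _ sI) => _ [].
    exact: riccati_lower.
  by move=> x; rewrite mul1r bformB gerBl; case: (psd _ sI) => _ [_ /(_ x)].
have ng := near_gain C B D S R0 R0pos w01 _ _ _ _ nP nPi
  (fun i : I => (psd _ (svalP i)).1.2) P0.
have [K XK] := near_const_bounded w01
  (near_constD (near_const_cst A) (near_constM w01 (near_const_cst B) ng)).
have [H YH] := near_const_bounded w01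
  (near_constD (near_const_cst C) (near_constM w01 (near_const_cst D) ng)).
clear w01; pose X s := A + B *m gain (Pf s) (Pif s).
pose Y s := b *: (C + D *m gain (Pf s) (Pif s)).
pose dG s := 2 * lam * a s *: Pi - ricc (Pf s) (Pif s).
move=> tI x.
have GE : qform (G t) x = a t * qform Pi x - qform (Pi - Pif t) x.
  by rewrite (bformD (a t *: Pi)) bformZ !bformB; ring.
rewrite -subr_ge0 -{}GE.
apply: (@comparison _ _ _ T0 G dG X Y (2 * K + (`|b| * H) ^+ 2)) tI x.
- by move=> x; rewrite /G /a PifT subrr mulr0 expR0 scale1r sub0r addrN bform0.
- move=> s sI.
  have da := mx_derive_withinZ (derive_within_expR (T := T) (t := s) (- (2 * lam)) T)
    (mx_derive_within_cst Pi).
  have := mx_derive_withinD da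
    (mx_derive_withinB (flow _ sI) (mx_derive_within_cst Pi)).
  by rewrite opprK scaler0 addr0 subr0.
- move=> s sI x; apply: lyap1_le; first exact: (XK (exist _ s sI)).
  by rewrite l1normZ ler_wpM2l //; exact: (YH (exist _ s sI)).
- move=> s sI x; have [[Pfs Pf0] [Pifs Pif0]] := psd _ sI.
  have /andP[a0 a1] := a01 _ sI.
  have := @ricc_upper _ _ _ A C Q B D S R0 R0s R0pos P Pi (Pf s) (Pif s)
    Ps Pis P0 Pfs Pifs Pf0 ricc0 x _ a1.
  have -> : Pif s - (1 - a s) *: Pi = G s.
    by rewrite /G scalerBl scale1r opprB addrCA.
  rewrite -/(X s); have := hb _ sI ((C + D *m gain (Pf s) (Pif s)) *m x).
  rewrite scalemxAl -/(Y s) /lyap /dG (bformB (_ *: Pi)) bformZ.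
  (* The derivative of the weight contributes [2 lam a Pi], which is at most [a] times the cost. *)
  have := ler_wpM2l a0 (lamPi x).
  have := ler_wpM2l a0 (cost_ge Q S R0 R0s R0pos x (gain (Pf s) (Pif s) *m x)).
  by move=> *; lra.
Qed.

End Bounds.

Lemma sqr_dot_le {R : realType} {n} (g x : 'cV[R]_n) :
  bform 1%:M x g ^+ 2 <= l1norm g ^+ 2 * sqnorm x.
Proof.
have /ler_normlP[_] := qform_le_l1norm (g *m g^T) x.
rewrite bform_outer (bform1C g) -expr2 => /le_trans; apply.
rewrite ler_wpM2r ?sqnorm_ge0 // (le_trans (l1norm_mul _ _)) //.
by rewrite l1norm_tr expr2.
Qed.

(** * Decay of the solution of the linear equation with a small source *)

Section VectorDecay.
Context {R : realType} {n m : nat}.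
Variables (A C Q : 'M[R]_n) (B D : 'M[R]_(n, m)) (S : 'M[R]_(m, n)) (R0 : 'M[R]_m).
Hypotheses (R0s : R0^T = R0) (R0pos : posdef_mx R0).
Local Notation ricc := (ricc A C Q B D S R0).
Local Notation gain := (gain C B D S R0).

Variables (T : R) (P Pi : 'M[R]_n) (Pf Pif : R -> 'M[R]_n).
Hypothesis T0 : 0 < T.
Hypotheses (Ps : P^T = P) (Pis : Pi^T = Pi).
Hypotheses (P0 : forall x, 0 <= qform P x).
Hypotheses (ricc0 : ricc P Pi = 0).
Hypothesis psd : forall t, t \in `[0, T] ->
  possemidef_mx (Pf t) /\ possemidef_mx (Pif t).
Hypothesis flow : forall t, t \in `[0, T] ->
  mx_derive_within T Pif t (- ricc (Pf t) (Pif t)).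
Hypothesis PifT : Pif T = 0.
Hypothesis Pif_le : forall t, t \in `[0, T] -> forall x, 0 <= qform (Pi - Pif t) x.

Local Notation X t := (A + B *m gain (Pf t) (Pif t)).

Variables (e g : R -> 'cV[R]_n).
Hypothesis flow_e : forall t, t \in `[0, T] ->
  mx_derive_within T e t (- ((X t)^T *m e t + g t)).

Variables (pi0 pi1 delta KX KE Kg lam nu k K : R).
Hypothesis Pi_ge : forall x, pi0 * sqnorm x <= qform Pi x.
Hypothesis Pi_le : forall x, qform Pi x <= pi1 * sqnorm x.
Hypothesis delta_le : forall x,
  delta * sqnorm x <= qform (Q - S^T *m invmx R0 *m S) x.
Hypothesis X_le : forall t, t \in `[0, T] -> l1norm (X t) <= KX.
Hypothesis E_le : forall t, t \in `[0, T] -> forall x,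
  qform (weightR D R0 P) ((gain (Pf t) (Pif t) - gain P Pi) *m x)
    <= KE * sqnorm x.
Hypothesis g_le : forall t, t \in `[0, T] ->
  l1norm (g t) <= Kg * expR (- (2 * lam) * (T - t)).
Hypotheses (nu0 : 0 < nu) (nu_lam : nu <= 2 * lam) (k1 : 1 <= k).
Hypothesis gap : 1 <= k * delta - KE - 2 * nu * k * pi1.
Hypothesis K_g : Kg ^+ 2 / nu <= K.
Hypothesis K_e : l1norm (e T) ^+ 2 <= K * pi0.

(* For the closed-loop matrix at time [t], the Lyapunov inequality of [Pi] holds
   only up to the square of the gain error; a large multiple of [Pif], whose
   equation has the source term [cost], absorbs it. *)
Lemma vector_decay t : t \in `[0, T] -> forall x,
  bform 1%:M x (e t) ^+ 2
    <= K * expR (- nu * (T - t)) * qform ((k - 1) *: Pif t + Pi) x.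
Proof.
have K0 : 0 <= K by apply: le_trans K_g; rewrite divr_ge0 ?sqr_ge0 ?ltW.
pose phi t := K * expR (- nu * (T - t)).
pose Z t := (k - 1) *: Pif t + Pi.
pose G t := phi t *: Z t - e t *m (e t)^T.
pose de t := - ((X t)^T *m e t + g t).
pose dG t := (K * (nu * expR (- nu * (T - t)))) *: Z t
  + phi t *: ((k - 1) *: - ricc (Pf t) (Pif t)) - (de t *m (e t)^T + e t *m (de t)^T).
have GE s x : qform (G s) x = phi s * qform (Z s) x - bform 1%:M x (e s) ^+ 2.
  by rewrite bformB bformZ bform_outer (bform1C (e s)) expr2.
have phi0 s : 0 <= phi s by rewrite mulr_ge0 ?expR_ge0.
move=> tI x; rewrite -subr_ge0 -GE.
(* The shift by [nu / 2] adds [nu G] to the Lyapunov form. Its part [- nu e e^T] will absorb the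
   products of [e] with the source [g]; its part [nu phi Z], together with the derivative of [phi],
   accounts for the [2 * nu] in [gap]. *)
apply: (@comparison _ _ _ T0 G dG (fun s => X s + (nu / 2) *: 1%:M) (fun=> 0)
  (2 * (KX + l1norm ((nu / 2) *: 1%:M : 'M[R]_n)) + l1norm (0 : 'M[R]_n) ^+ 2)) tI x.
- move=> x; rewrite GE /phi /Z PifT scaler0 add0r subrr mulr0 expR0 mulr1 subr_ge0.
  apply: le_trans (sqr_dot_le _ _) _.
  apply: le_trans (ler_wpM2l K0 (Pi_ge x)).
  by rewrite mulrA ler_wpM2r ?sqnorm_ge0.
- move=> s sI.
  have dphi := derive_withinMl K (derive_within_expR (T := T) (t := s) (- nu) T).
  rewrite opprK in dphi.
  have dZ := mx_derive_withinD (mx_derive_withinMl (k - 1) (flow _ sI))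
    (mx_derive_within_cst Pi).
  rewrite addr0 in dZ.
  exact: (mx_derive_withinB (mx_derive_withinZ dphi dZ)
    (mx_derive_within_mul (flow_e _ sI) (mx_derive_within_tr (flow_e _ sI)))).
- move=> s sI x; apply: lyap1_le => //.
  by apply: le_trans (l1normD _ _) _; rewrite lerD2r X_le.
- move=> s sI x; have [[Pfs Pf0] [Pifs Pif0]] := psd _ sI.
  have := @ricc_mixed _ _ _ A C Q B D S R0 R0s R0pos P Pi (Pf s) (Pif s)
    Ps Pis P0 Pfs Pifs Pf0 ricc0 x _ k1.
  rewrite -/(Z s).
  have hE := E_le _ sI x.
  have := cost_ge Q S R0 R0s R0pos x (gain (Pf s) (Pif s) *m x).
  have hd := delta_le x.
  have hZ : qform (Z s) x <= k * (pi1 * sqnorm x).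
    apply: le_trans (ler_wpM2l _ (Pi_le x)); last by apply: le_trans k1.
    rewrite /Z bformD bformZ.
    have := Pif_le _ sI x; rewrite bformB subr_ge0.
    have k10 : 0 <= k - 1 by rewrite subr_ge0.
    move=> /(ler_wpM2l k10); lra.
  have hg : bform 1%:M x (g s) ^+ 2 <= nu * phi s * sqnorm x.
    apply: le_trans (sqr_dot_le _ _) _; rewrite ler_wpM2r ?sqnorm_ge0 //.
    have sT : 0 <= T - s by move: sI; rewrite in_itv subr_ge0 /= => /andP[].
    set a := expR (- (2 * lam) * (T - s)).
    have a1 : a <= 1.
      rewrite -expR0 ler_expR mulNr oppr_le0 mulr_ge0 //.
      by apply: le_trans nu_lam; exact: ltW.
    have a_nu : a <= expR (- nu * (T - s)).
      by rewrite ler_expR ler_wpM2r // lerN2.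
    apply: (@le_trans _ _ ((Kg * a) ^+ 2)).
      rewrite lerXn2r ?nnegrE ?l1norm_ge0 ?g_le //.
      by apply: le_trans (l1norm_ge0 _) (g_le _ sI).
    rewrite exprMn /phi.
    have a2 : a ^+ 2 <= expR (- nu * (T - s)).
      by apply: le_trans a_nu; rewrite expr2 ler_piMl ?expR_ge0.
    apply: le_trans (ler_wpM2l (sqr_ge0 _) a2) _.
    rewrite mulrA ler_wpM2r ?expR_ge0 //.
    by rewrite mulrC -ler_pdivrMr.
  have Xe y : bform 1%:M y ((X s)^T *m e s) = bform 1%:M (X s *m y) (e s).
    by rewrite -bform_mulr mul1mx -bform_mull mulmx1.
  have GB y z : bform (G s) y z
      = phi s * bform (Z s) y z - bform 1%:M y (e s) * bform 1%:M z (e s).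
    by rewrite bformB bformZ bform_outer (bform1C (e s)).
  have dGE : qform (dG s) x = nu * phi s * qform (Z s) x
      - phi s * ((k - 1) * qform (ricc (Pf s) (Pif s)) x)
      + 2 * (bform 1%:M (X s *m x) (e s) + bform 1%:M x (g s)) * bform 1%:M x (e s).
    rewrite bformB (bformD (_ *: Z s)) (bformD (de s *m _)) !bformZ bformN.
    rewrite !bform_outer (bform1C (e s)) (bform1C (de s)).
    have -> : bform 1%:M x (de s) = - (bform 1%:M (X s *m x) (e s) + bform 1%:M x (g s)).
      by rewrite -Xe -bformDr -mulN1r -bformZr scaleN1r.
    by rewrite /phi; ring.
  rewrite /lyap /= mul0mx bformr0 addr0.
  rewrite (mulmxDl (X s) _ x) -scalemxAl mul1mx dGE.
  rewrite !bformDl !bformDr !bformZl !bformZr !GB.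
  have := phi0 s; have := sqnorm_ge0 x; move: hg hZ hd hE.
  move: (qform (weightR D R0 P) _).
  move: (qform (Z s) x) (bform 1%:M x (e s)) (bform 1%:M x (g s)) (sqnorm x).
  move: (bform 1%:M (X s *m x) (e s)) (bform (Z s) (X s *m x) x)
    (bform (Z s) x (X s *m x)) (phi s).
  move: (cost _ _ _ _ _) (qform (ricc _ _) _).
  move: (qform (Q - _) x) => c0 c r Xe1 Z1 Z2 ph z ex gx q w hg hZ hd hE s0 ph0 hc hm.
  have sq := sqr_ge0 (nu * ex - gx).
  have k0 : 0 <= k by apply: le_trans k1.
  have m1 : ph * (Z1 + Z2 - (k - 1) * r) <= ph * (KE * q - k * (delta * q)).
    by rewrite ler_wpM2l //; have := ler_wpM2l k0 (le_trans hd hc); lra.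
  have m2 : nu * ph * z <= nu * ph * (k * (pi1 * q)).
    by rewrite ler_wpM2l // mulr_ge0 // ltW.
  have m3 := ler_wpM2l (mulr_ge0 ph0 s0) gap.
  (* Young's inequality, using that the squared source is at most [nu * ph * q]. The loss [ph * q]
     is covered by the 1 in [gap]. *)
  have m4 : - (ph * q) <= nu * ex ^+ 2 - 2 * (gx * ex).
    rewrite -(ler_pM2l nu0); lra.
  lra.
Qed.

End VectorDecay.

(** * Uniform rates over all horizons *)

(* Taking these triples (horizon, solution, time) as the index of [near_const]
   makes its constants independent of the horizon. *)
Record horizon_point {R : realType} {n m : nat} (L : lq_data R n m) := HorizonPoint {
  hor_T : R; hor_P : R -> 'M[R]_n; hor_Pi : R -> 'M[R]_n; hor_p : R -> 'cV[R]_n;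
  hor_t : R;
  hor_T_gt0 : 0 < hor_T;
  hor_sol : finite_horizon_solution L hor_T hor_P hor_Pi hor_p;
  hor_t_in : hor_t \in `[0, hor_T] }.

Arguments hor_T {R n m L}.
Arguments hor_P {R n m L}.
Arguments hor_Pi {R n m L}.
Arguments hor_p {R n m L}.
Arguments hor_t {R n m L}.
Arguments hor_T_gt0 {R n m L}.
Arguments hor_sol {R n m L}.
Arguments hor_t_in {R n m L}.

Section Turnpike.
Context {R : realType} {n m : nat} (L : lq_data R n m).
Variables (P Pi : 'M[R]_n) (p : 'cV[R]_n).
Hypothesis h1 : H1 L.
Hypothesis hP : algebraic_solution L P Pi p.

Local Notation decay l := (fun i : horizon_point L =>
  expR (- l * (hor_T i - hor_t i))).

Lemma decay01 (l : R) : 0 <= l -> forall i, 0 <= decay l i <= 1.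
Proof.
move=> l0 [T ? ? ? t ? ? /=]; rewrite in_itv /= => /andP[_ tT].
by rewrite expR_ge0 -expR0 ler_expR mulNr oppr_le0 mulr_ge0 // subr_ge0.
Qed.

Lemma near_decay_le {l1 l2 : R} {k l} {M : horizon_point L -> 'M[R]_(k, l)} {M0} :
  0 <= l2 <= l1 -> near_const (decay l1) M M0 -> near_const (decay l2) M M0.
Proof.
move=> /andP[l20 l21] /(near_const_pos (decay01 l1 (le_trans l20 l21)))[K K0 MK].
exists K => i; apply: le_trans (MK i) _; rewrite ler_wpM2l // ler_expR.
rewrite ler_wpM2r ?lerN2 // subr_ge0.
by have := hor_t_in i; rewrite in_itv /= => /andP[].
Qed.

Lemma algebraic_syms : [/\ P^T = P, Pi^T = Pi & (cR L)^T = cR L].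
Proof. by case: hP h1 => -[? _] [? _] _ [[? _] _ _]. Qed.

Lemma posdef_ge0 {k} {M : 'M[R]_k} x : posdef_mx M -> 0 <= qform M x.
Proof.
by move=> [_ Mp]; have [->|/Mp/ltW //] := eqVneq x 0; rewrite bformr0.
Qed.

Lemma rate_exists : exists delta c : R, [/\ 0 < delta, 0 < c,
  forall x, delta * sqnorm x
    <= qform (cQ L - (cS L)^T *m invmx (cR L) *m cS L) x,
  forall x, delta * sqnorm x
    <= qform (hatQ L - (cS L)^T *m invmx (cR L) *m cS L) x
  & forall x, qform P x <= c * sqnorm x /\ qform Pi x <= c * sqnorm x].
Proof.
case: h1 => _ /posdef_coercive[d1 d10 hd1] /posdef_coercive[d2 d20 hd2].
exists (Num.min d1 d2), (l1norm P + l1norm Pi + 1); split.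
- by rewrite lt_min d10.
- by rewrite ltr_wpDl // addr_ge0 // l1norm_ge0.
- move=> x; apply: le_trans (hd1 x); rewrite ler_wpM2r ?sqnorm_ge0 //.
  by rewrite ge_min lexx.
- move=> x; apply: le_trans (hd2 x); rewrite ler_wpM2r ?sqnorm_ge0 //.
  by rewrite ge_min lexx orbT.
- move=> x; have s0 := sqnorm_ge0 x.
  have /ler_normlP[_ hp] := qform_le_l1norm P x.
  have /ler_normlP[_ hpi] := qform_le_l1norm Pi x.
  by split; [apply: le_trans hp _|apply: le_trans hpi _]; rewrite ler_wpM2r //;
    have := l1norm_ge0 P; have := l1norm_ge0 Pi; lra.
Qed.

(** Two passes through the same lemmas: the first equation is its own coupling, and its bounds then
    serve as the coupling of the second. *)
Lemma horizon_bounds {lam : R} : 0 <= lam ->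
  (forall x, 2 * lam * qform P x
    <= qform (cQ L - (cS L)^T *m invmx (cR L) *m cS L) x) ->
  (forall x, 2 * lam * qform Pi x
    <= qform (hatQ L - (cS L)^T *m invmx (cR L) *m cS L) x) ->
  forall T PT PiT pT, 0 < T -> finite_horizon_solution L T PT PiT pT ->
  forall t, t \in `[0, T] -> forall x,
    0 <= qform (P - PT t) x <= expR (- (2 * lam) * (T - t)) * qform P x /\
    0 <= qform (Pi - PiT t) x <= expR (- (2 * lam) * (T - t)) * qform Pi x.
Proof.
move=> lam0 lamP lamPi T PT PiT pT T0 [dP [dPi [dp [[C1P C1Pi _] psd eqs [PT0 PiT0 _]]]]].
have [Ps Pis Rs] := algebraic_syms.
have [Rpos _ _] := h1; have [Ppos Pipos [ric0 ricPi0 _]] := hP.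
have P0 x : 0 <= qform P x := posdef_ge0 x Ppos.
have Pi0 x : 0 <= qform Pi x := posdef_ge0 x Pipos.
have flowP t : t \in `[0, T] -> mx_derive_within T PT t (- riccatiP L (PT t)).
  move=> tI; have [/eqP + _ _] := eqs _ tI; rewrite addr_eq0 => /eqP <-.
  exact: mx_derive_withinP.
have flowPi t : t \in `[0, T] ->
    mx_derive_within T PiT t (- riccatiPi L (PT t) (PiT t)).
  move=> tI; have [_ /eqP + _] := eqs _ tI; rewrite addr_eq0 => /eqP <-.
  exact: mx_derive_withinP.
have psdP t : t \in `[0, T] -> possemidef_mx (PT t) /\ possemidef_mx (PT t).
  by move=> /psd[].
have bP t : t \in `[0, T] -> forall x,
    0 <= qform (P - PT t) x <= expR (- (2 * lam) * (T - t)) * qform P x.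
  have cpl : (P = P /\ PT = PT) \/ forall t, t \in `[0, T] -> forall x,
      0 <= qform (P - PT t) x <= expR (- (2 * lam) * (T - t)) * qform P x by left.
  move=> tI x; apply/andP; split.
    exact: (riccati_lower (cA L) (cC L) (cQ L) (cB L) (cD L) (cS L) (cR L)
      Rs Rpos T lam P P PT PT T0 Ps Ps P0 P0 ric0 psdP flowP PT0 cpl).
  exact: (riccati_upper (cA L) (cC L) (cQ L) (cB L) (cD L) (cS L) (cR L)
    Rs Rpos T lam P P PT PT T0 Ps Ps P0 P0 ric0 lam0 lamP psdP flowP PT0 cpl).
move=> t tI x; split; first exact: bP.
have cpl : (P = Pi /\ PT = PiT) \/ forall t, t \in `[0, T] -> forall x,
    0 <= qform (P - PT t) x <= expR (- (2 * lam) * (T - t)) * qform P x by right.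
apply/andP; split.
  exact: (riccati_lower (hatA L) (hatC L) (hatQ L) (cB L) (cD L) (cS L) (cR L)
    Rs Rpos T lam P Pi PT PiT T0 Ps Pis P0 Pi0 ricPi0 psd flowPi PiT0 cpl).
exact: (riccati_upper (hatA L) (hatC L) (hatQ L) (cB L) (cD L) (cS L) (cR L)
  Rs Rpos T lam P Pi PT PiT T0 Ps Pis P0 Pi0 ricPi0 lam0 lamPi psd flowPi PiT0 cpl).
Qed.

Section Rate.
Variables (delta c : R).
Hypotheses (delta0 : 0 < delta) (c0 : 0 < c).
Hypothesis deltaP : forall x,
  delta * sqnorm x <= qform (cQ L - (cS L)^T *m invmx (cR L) *m cS L) x.
Hypothesis deltaPi : forall x,
  delta * sqnorm x <= qform (hatQ L - (cS L)^T *m invmx (cR L) *m cS L) x.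
Hypothesis cP : forall x, qform P x <= c * sqnorm x.
Hypothesis cPi : forall x, qform Pi x <= c * sqnorm x.

(** The costs dominate [delta |x|^2], hence [lam P] and [lam Pi]; in the notation of
    [horizon_bounds] the parameter is therefore [lam / 2]. *)
Let lam : R := delta / c.
(** Chosen so that [2 nu k c] is half of [k delta], whatever [k] is; the other half is left for the
    gain error. *)
Let nu : R := lam / 4.

Let lam0 : 0 < lam. Proof. by rewrite divr_gt0. Qed.
Let nu0 : 0 < nu. Proof. by rewrite divr_gt0. Qed.
Let lam_c : lam * c = delta. Proof. by rewrite mulfVK // gt_eqF. Qed.

Let lam2 : 2 * (lam / 2) = lam. Proof. by rewrite mulrC divfK. Qed.

Let lamD : decay lam = decay (2 * (lam / 2)).
Proof. by rewrite lam2. Qed.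

Let w01 : forall i, 0 <= decay lam i <= 1.
Proof. exact/decay01/ltW. Qed.

Lemma bounds_at (i : horizon_point L) x :
  0 <= qform (P - hor_P i (hor_t i)) x <= decay lam i * qform P x /\
  0 <= qform (Pi - hor_Pi i (hor_t i)) x <= decay lam i * qform Pi x.
Proof.
rewrite lamD; apply: (@horizon_bounds (lam / 2)) => [|y|y|||].
- by rewrite ltW // divr_gt0.
- rewrite lam2; apply: le_trans (deltaP y); rewrite -lam_c -mulrA.
  by rewrite ler_wpM2l // ltW.
- rewrite lam2; apply: le_trans (deltaPi y); rewrite -lam_c -mulrA.
  by rewrite ler_wpM2l // ltW.
- exact: hor_T_gt0.
- exact: hor_sol.
- exact: hor_t_in.
Qed.

Lemma psd_at (i : horizon_point L) :
  possemidef_mx (hor_P i (hor_t i)) /\ possemidef_mx (hor_Pi i (hor_t i)).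
Proof.
by case: (hor_sol i) => ? [? [? [_ psd _ _]]]; exact: psd (hor_t_in i).
Qed.

Lemma near_P : near_const (decay lam) (fun i => hor_P i (hor_t i)) P.
Proof.
have [Ps Pis Rs] := algebraic_syms; apply: near_const_sandwich => // i.
- by case: (psd_at i) => -[].
- by move=> x; case: (bounds_at i x) => /andP[].
- by move=> x; case: (bounds_at i x) => /andP[].
Qed.

Lemma near_Pi : near_const (decay lam) (fun i => hor_Pi i (hor_t i)) Pi.
Proof.
have [Ps Pis Rs] := algebraic_syms; apply: near_const_sandwich => // i.
- by case: (psd_at i) => _ [].
- by move=> x; case: (bounds_at i x) => _ /andP[].
- by move=> x; case: (bounds_at i x) => _ /andP[].
Qed.

Let Rpos : posdef_mx (cR L). Proof. by case: h1. Qed.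
Let P0 x : 0 <= qform P x. Proof. by apply: posdef_ge0; case: hP. Qed.
Let Pf0 (i : horizon_point L) x : 0 <= qform (hor_P i (hor_t i)) x.
Proof. by have [[_ h] _] := psd_at i; exact: h. Qed.

Lemma near_Theta :
  near_const (decay lam) (fun i => Theta_of L (hor_P i (hor_t i))) (Theta_of L P).
Proof.
exact: (near_gain (cC L) (cB L) (cD L) (cS L) (cR L) Rpos w01 _ _ _ _
  near_P near_P Pf0 P0).
Qed.

Lemma near_Thetabar : near_const (decay lam)
  (fun i => Thetabar_of L (hor_P i (hor_t i)) (hor_Pi i (hor_t i)))
  (Thetabar_of L P Pi).
Proof.
exact: (near_gain (hatC L) (cB L) (cD L) (cS L) (cR L) Rpos w01 _ _ _ _
  near_P near_Pi Pf0 P0).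
Qed.

Lemma near_closed_loop (M : 'M[R]_n) (N : 'M[R]_(n, m)) : near_const (decay lam)
  (fun i => M + N *m Thetabar_of L (hor_P i (hor_t i)) (hor_Pi i (hor_t i)))
  (M + N *m Thetabar_of L P Pi).
Proof.
exact: (near_constD (near_const_cst M) (near_constM w01 (near_const_cst N) near_Thetabar)).
Qed.

(** This is the source in the equation of [p_T - p]: the finite-horizon operator evaluated at the
    stationary [p]. It is small because the algebraic equation makes its limit vanish. *)
Lemma near_linear_p : near_const (decay lam)
  (fun i => linear_p L (hor_P i (hor_t i)) (hor_Pi i (hor_t i)) p) 0.
Proof.
have [_ _ [_ _ <-]] := hP.
have nX := near_const_tr (near_closed_loop (hatA L) (cB L)).
have nY := near_const_tr (near_closed_loop (hatC L) (cD L)).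
exact: (near_constD (near_constD (near_constD (near_constD
  (near_constM w01 nX (near_const_cst p))
  (near_constM w01 (near_constM w01 nY near_P) (near_const_cst _)))
  (near_constM w01 (near_const_tr near_Thetabar) (near_const_cst _)))
  (near_constM w01 near_Pi (near_const_cst _))) (near_const_cst _)).
Qed.

(** The decay lemma bounds squared entries at rate [nu]; the square root leaves [nu / 2]. *)
Lemma near_p : near_const (decay (nu / 2)) (fun i => hor_p i (hor_t i)) p.
Proof.
have [Ps Pis Rs] := algebraic_syms; have [_ Pipos [_ ricPi0 _]] := hP.
have [pi0 pi00 hpi0] := posdef_coercive Pipos.
have [KX hKX] := near_const_bounded w01 (near_closed_loop (hatA L) (cB L)).
have [Kg Kg0 hKg] := near_const_pos w01 near_linear_p.
have [KT KT0 hKT] := near_const_pos w01 near_Thetabar.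
pose KE := KT ^+ 2 * l1norm (weightR (cD L) (cR L) P).
have KE0 : 0 <= KE by rewrite mulr_ge0 ?sqr_ge0 ?l1norm_ge0.
have hKE (i : horizon_point L) x : qform (weightR (cD L) (cR L) P)
    ((Thetabar_of L (hor_P i (hor_t i)) (hor_Pi i (hor_t i)) - Thetabar_of L P Pi)
      *m x) <= KE * sqnorm x.
  set E := _ - Thetabar_of L P Pi; rewrite -bform_congr.
  have /ler_normlP[_] := qform_le_l1norm (E^T *m weightR (cD L) (cR L) P *m E) x.
  move=> /le_trans; apply; rewrite ler_wpM2r ?sqnorm_ge0 //.
  have EK : l1norm E <= KT.
    apply: le_trans (hKT i) _; rewrite -[leRHS]mulr1 ler_wpM2l //.
    by case/andP: (w01 i).
  apply: le_trans (l1norm_mul _ _) _; rewrite /KE expr2 mulrAC.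
  apply: ler_pM => //; rewrite ?l1norm_ge0 //.
  apply: le_trans (l1norm_mul _ _) _; rewrite l1norm_tr.
  by rewrite ler_wpM2r ?l1norm_ge0.
(* Half of [k delta] is then [delta / 2 + KE + 1], which covers the gain error [KE] and the 1
   required by [gap]. *)
pose k := 1 + 2 * (KE + 1) / delta.
have k1 : 1 <= k by rewrite lerDl divr_ge0 ?mulr_ge0 ?addr_ge0 // ltW.
have gap : 1 <= k * delta - KE - 2 * nu * k * c.
  have -> : 2 * nu * k * c = k * delta / 2 by rewrite -lam_c /nu; field.
  have -> : k * delta = delta + 2 * (KE + 1).
    by rewrite /k; field; rewrite gt_eqF.
  by move: KE0 delta0; lra.
(* The first summand handles the source, the second the terminal error, which is [- p] because [p_T]
   vanishes at the horizon. *)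
pose K := Kg ^+ 2 / nu + l1norm p ^+ 2 / pi0.
have Kg_K : Kg ^+ 2 / nu <= K by rewrite lerDl divr_ge0 ?sqr_ge0 ?ltW.
have p_K : l1norm p ^+ 2 <= K * pi0.
  by rewrite -ler_pdivrMr // lerDr divr_ge0 ?sqr_ge0 ?ltW.
have K0 : 0 <= K by apply: le_trans Kg_K; rewrite divr_ge0 ?sqr_ge0 ?ltW.
have sq_le (i : horizon_point L) x :
    bform 1%:M x (hor_p i (hor_t i) - p) ^+ 2 <= K * k * decay nu i * qform Pi x.
  case: i => T PT PiT pT t T0 sol tI /=.
  (* Every time [s] of this horizon is again an index of the uniform estimates, so these hold along
     the whole trajectory with the same constants. *)
  pose pt s sI := @HorizonPoint _ _ _ L T PT PiT pT s T0 sol sI.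
  have [dP [dPi [dp [[_ C1Pi C1p] psd eqs [_ PiT0 pT0]]]]] := sol.
  have flowPi s : s \in `[0, T] ->
      mx_derive_within T PiT s (- riccatiPi L (PT s) (PiT s)).
    move=> sI; have [_ /eqP + _] := eqs _ sI; rewrite addr_eq0 => /eqP <-.
    exact: mx_derive_withinP.
  have PiT_le s : s \in `[0, T] -> forall x, 0 <= qform (Pi - PiT s) x.
    by move=> sI y; case: (bounds_at (pt s sI) y) => _ /andP[].
  have flow_e s : s \in `[0, T] -> mx_derive_within T (fun u => pT u - p) s
      (- ((hatA L + cB L *m Thetabar_of L (PT s) (PiT s))^T *m (pT s - p)
          + linear_p L (PT s) (PiT s) p)).
    move=> sI; have [_ _ /eqP] := eqs _ sI; rewrite addr_eq0 => /eqP dpE.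
    have := mx_derive_withinB (mx_derive_withinP C1p sI) (mx_derive_within_cst p).
    rewrite subr0 dpE; congr mx_derive_within; congr (- _).
    (* [linear_p] is affine in its last argument, so its value at [pT s] is the closed-loop matrix
       applied to the error plus its value at [p]. *)
    by rewrite /linear_p mulmxBr !addrA subrK.
  have h := @vector_decay _ _ _ (hatA L) (hatC L) (hatQ L) (cB L) (cD L) (cS L) (cR L)
    Rs Rpos T P Pi PT PiT T0 Ps Pis P0 ricPi0 psd flowPi PiT0 PiT_le
    (fun u => pT u - p) (fun u => linear_p L (PT u) (PiT u) p) flow_e
    pi0 c delta KX KE Kg (lam / 2) nu k K hpi0 cPi deltaPi
    (fun s sI => hKX (pt s sI)) (fun s sI => hKE (pt s sI)).
  apply: le_trans (h _ _ _ _ _ _ _ t tI x) _ => //.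
  - by move=> s sI; rewrite lam2; have := hKg (pt s sI); rewrite subr0.
  - by rewrite lam2 /nu; move: lam0; lra.
  - by rewrite pT0 sub0r l1normN.
  (* The weight [(k - 1) PiT + Pi] is at most [k Pi], because [PiT <= Pi]. *)
  - rewrite [K * k * _]mulrAC -[leRHS]mulrA ler_wpM2l ?mulr_ge0 ?expR_ge0 //.
    rewrite bformD bformZ; have := PiT_le t tI x; rewrite bformB subr_ge0.
    have k10 : 0 <= k - 1 by rewrite subr_ge0.
    by move=> /(ler_wpM2l k10); lra.
exists (\sum_(i < n) \sum_(j < 1) Num.sqrt (K * k * Pi i i)) => i.
rewrite /l1norm mulr_suml; apply: ler_sum => s _; rewrite mulr_suml.
apply: ler_sum => j _; rewrite (ord1 j).
have Pis0 : 0 <= Pi s s.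
  by have := posdef_ge0 (delta_mx s 0) Pipos; rewrite bform_delta.
have Kk0 : 0 <= K * k * Pi s s by rewrite !mulr_ge0 // (le_trans ler01).
rewrite -(@ler_pXn2r _ 2) ?nnegrE ?mulr_ge0 ?sqrtr_ge0 ?expR_ge0 //.
rewrite real_normK ?num_real // exprMn sqr_sqrtr //.
have := sq_le i (delta_mx s 0); rewrite bform_delta.
have -> : bform 1%:M (delta_mx s 0) (hor_p i (hor_t i) - p)
    = (hor_p i (hor_t i) - p) s 0.
  by rewrite /bform mulmx1 trmx_delta -rowE mxE.
move=> /le_trans; apply; rewrite mulrAC ler_wpM2l // expr2 -expRD ler_expR.
by rewrite -mulrDl -opprD -splitr.
Qed.

Lemma near_theta : near_const (decay (nu / 2))
  (fun i => theta_of L (hor_P i (hor_t i)) (hor_p i (hor_t i))) (theta_of L P p).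
Proof.
have nu20 : 0 <= nu / 2 by rewrite ltW // divr_gt0.
have v01 := decay01 _ nu20.
have nP : near_const (decay (nu / 2)) (fun i => hor_P i (hor_t i)) P.
  by apply: near_decay_le near_P; rewrite nu20 /= /nu; move: lam0; lra.
have nR := near_invR (cD L) (cR L) Rpos v01 _ _ nP Pf0 P0.
have nS := near_constD (near_constD (near_constM v01 (near_const_cst (cB L)^T) near_p)
  (near_constM v01 (near_constM v01 (near_const_cst (cD L)^T) nP) (near_const_cst (csigma L))))
  (near_const_cst (cr L)).
exact: (near_constN (near_constM v01 nR nS)).
Qed.

End Rate.
End Turnpike.

Theorem theorem4p1 (R : realType) (d : measure_display)
  (Omega : measurableType d) (Pr : probability Omega R)
  (F : R -> set (set Omega)) (W : R -> Omega -> R)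
  (hF : complete_filtration Pr F) (hW : brownian_motion Pr F W)
  (n m : nat) (L : lq_data R n m)
  (symQ : symmetric_mx (cQ L)) (symQbar : symmetric_mx (cQbar L))
  (symR : symmetric_mx (cR L))
  (h1 : H1 L) (h2 : H2 L Pr F W)
  (P Pi : 'M[R]_n) (p : 'cV[R]_n) (hP : algebraic_solution L P Pi p) :
  (exists K lambda : R, [/\ 0 < K, 0 < lambda &
     forall (T : R) (PT PiT : R -> 'M[R]_n) (pT : R -> 'cV[R]_n),
       0 < T -> finite_horizon_solution L T PT PiT pT ->
       forall t : R, t \in `[0, T] ->
       [/\ frobenius (Theta_of L (PT t) - Theta_of L P)
             <= K * expR (- lambda * (T - t)),
           frobenius (Thetabar_of L (PT t) (PiT t) - Thetabar_of L P Pi)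
             <= K * expR (- lambda * (T - t)),
           enorm (pT t - p) <= K * expR (- lambda * (T - t))
         & enorm (theta_of L (PT t) (pT t) - theta_of L P p)
             <= K * expR (- lambda * (T - t))]]) /\
  (exists M : R,
     forall (T : R) (PT PiT : R -> 'M[R]_n) (pT : R -> 'cV[R]_n),
       0 < T -> finite_horizon_solution L T PT PiT pT ->
       forall t : R, t \in `[0, T] ->
       [/\ frobenius (Theta_of L (PT t)) <= M,
           frobenius (Thetabar_of L (PT t) (PiT t)) <= M,
           enorm (theta_of L (PT t) (pT t)) <= M
         & enorm (pT t) <= M]).
Proof.
have [delta [c [delta0 c0 dP dPi cPPi]]] := rate_exists L P Pi h1.
have cP x := (cPPi x).1; have cPi x := (cPPi x).2.
pose lam := delta / c; have lam0 : 0 < lam by rewrite divr_gt0.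
have nu0 : 0 < lam / 4 / 2 by rewrite !divr_gt0.
have nu_lam : 0 <= lam / 4 / 2 <= lam by apply/andP; split; lra.
have [K1 K10 n1] := near_const_pos (decay01 L _ (ltW nu0))
  (near_decay_le L nu_lam (near_Theta L P Pi p h1 hP delta c delta0 c0 dP dPi cP cPi)).
have [K2 K20 n2] := near_const_pos (decay01 L _ (ltW nu0))
  (near_decay_le L nu_lam (near_Thetabar L P Pi p h1 hP delta c delta0 c0 dP dPi cP cPi)).
have [K3 K30 n3] := near_const_pos (decay01 L _ (ltW nu0))
  (near_p L P Pi p h1 hP delta c delta0 c0 dP dPi cP cPi).
have [K4 K40 n4] := near_const_pos (decay01 L _ (ltW nu0))
  (near_theta L P Pi p h1 hP delta c delta0 c0 dP dPi cP cPi).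
(* The four constants are nonnegative but may vanish; the 1 makes [K] positive. *)
pose K := K1 + K2 + K3 + K4 + 1.
have main (i : horizon_point L) :
    [/\ l1norm (Theta_of L (hor_P i (hor_t i)) - Theta_of L P)
          <= K * expR (- (lam / 4 / 2) * (hor_T i - hor_t i)),
        l1norm (Thetabar_of L (hor_P i (hor_t i)) (hor_Pi i (hor_t i))
                - Thetabar_of L P Pi)
          <= K * expR (- (lam / 4 / 2) * (hor_T i - hor_t i)),
        l1norm (hor_p i (hor_t i) - p)
          <= K * expR (- (lam / 4 / 2) * (hor_T i - hor_t i))
      & l1norm (theta_of L (hor_P i (hor_t i)) (hor_p i (hor_t i)) - theta_of L P p)
          <= K * expR (- (lam / 4 / 2) * (hor_T i - hor_t i))].
  have K_le H (M : R) : M <= H * expR (- (lam / 4 / 2) * (hor_T i - hor_t i)) ->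
      H <= K -> M <= K * expR (- (lam / 4 / 2) * (hor_T i - hor_t i)).
    by move=> /le_trans MH HK; apply: MH; rewrite ler_wpM2r ?expR_ge0.
  by split; [apply: K_le (n1 i) _|apply: K_le (n2 i) _|apply: K_le (n3 i) _
    |apply: K_le (n4 i) _]; rewrite /K; lra.
split.
  exists K, (lam / 4 / 2); split => //; first by rewrite /K; lra.
  move=> T PT PiT pT T0 sol t tI.
  have [a1 a2 a3 a4] := main (HorizonPoint _ _ _ L T PT PiT pT t T0 sol tI).
  by split; [apply: le_trans a1|apply: le_trans a2|apply: le_trans a3
    |apply: le_trans a4]; rewrite ?frobenius_le_l1norm ?enorm_le_l1norm.
have v01 := decay01 L _ (ltW nu0).
have K0 : 0 <= K by rewrite /K; lra.
exists (K + l1norm (Theta_of L P) + l1norm (Thetabar_of L P Pi)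
  + l1norm (theta_of L P p) + l1norm p).
move=> T PT PiT pT T0 sol t tI.
pose i := HorizonPoint _ _ _ L T PT PiT pT t T0 sol tI.
have bnd k l (M M0 : 'M[R]_(k, l)) :
    l1norm (M - M0) <= K * expR (- (lam / 4 / 2) * (hor_T i - hor_t i)) ->
    l1norm M <= K + l1norm M0.
  move=> MK; rewrite -[M in leLHS](subrK M0) (le_trans (l1normD _ _)) // lerD2r.
  apply: le_trans MK _; rewrite -[leRHS]mulr1 ler_wpM2l //.
  by case/andP: (v01 i).
have [/bnd a1 /bnd a2 /bnd a3 /bnd a4] := main i.
have := l1norm_ge0 (Theta_of L P); have := l1norm_ge0 (Thetabar_of L P Pi).
have := l1norm_ge0 (theta_of L P p); have := l1norm_ge0 p.
move=> s1 s2 s3 s4; move: a1 a2 a3 a4; rewrite /i /= => a1 a2 a3 a4; split.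
- by apply: le_trans (frobenius_le_l1norm _) _; apply: le_trans a1 _; lra.
- by apply: le_trans (frobenius_le_l1norm _) _; apply: le_trans a2 _; lra.
- by apply: le_trans (enorm_le_l1norm _) _; apply: le_trans a4 _; lra.
- by apply: le_trans (enorm_le_l1norm _) _; apply: le_trans a3 _; lra.
Qed.
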